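(* Let $(X,M)$ be a marked surface with all marked points on the boundary, and let $\mathcal{T}$ be a triangulation of $(X,M)$. Then $D(\mathcal{T})$ is a weak Postnikov diagram of degree $2$.
   Context: **Marked surfaces.** $(X,M)$ is a marked oriented Riemann surface with nonempty boundary, each boundary component being a circle; $M$ is the set of marked points, each of which lies on a boundary component, and each boundary component contains at least one marked point. $(X,M)$ is not a disk with $1$ or $2$ marked points. The boundary components are $\mathcal{C}_1,\dots,\mathcal{C}_b$, with $r_i$ marked points $p_{i1},\dots,p_{ir_i}$ on $\mathcal{C}_i$, numbered so that the surface lies on the right when moving along $\mathcal{C}_i$ from $p_{ij}$ to $p_{i,j+1}$ (second subscripts mod $r_i$). **Weak Postnikov diagrams.** A weak Postnikov diagram on $(X,M)$ consists of directed curves (strands) embedded in $X$, considered up to isotopy, one starting at each marked point and ending on the same boundary component on which it starts, with exactly one strand ending and exactly one strand starting at each marked point, such that: (a1) only two strands can cross at a given point and all crossings are transverse; (a2) there are finitely many crossing points; (a3) proceeding along a given strand, the other strands crossing it alternate between crossing it left to right and right to left (the two strands ending and starting at a marked point are regarded as crossing there). It has degree $k$ if, for all $i,j$, the strand starting at $p_{ij}$ ends at $p_{i,j+k}$. **The diagram $D(\mathcal{T})$.** A triangulation $\mathcal{T}$ of $(X,M)$ has as edges its internal arcs and the boundary intervals between consecutive marked points. In each triangle, with corners $P_1,P_2,P_3$ in anticlockwise order (indices mod 3), draw for each $i$ a directed segment parallel to the edge $P_iP_{i+1}$, starting at a point of the edge $P_{i-1}P_i$ close to $P_i$ and ending at a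 point of the edge $P_{i+1}P_{i+2}$ close to $P_{i+1}$; the three segments cross pairwise once. If an edge of the triangle is a boundary edge, the intersection of any segment with that edge is slid along the edge to the adjacent corner of the triangle. Segments in adjacent triangles are joined along internal edges; the resulting collection of strands is $D(\mathcal{T})$. *)

(* Defs.v *)
From HB Require Import structures.
From mathcomp Require Import all_boot all_order all_algebra.
From mathcomp Require Import all_classical all_reals all_analysis.
Set Implicit Arguments.
Unset Strict Implicit.
Unset Printing Implicit Defensive.
Import Order.TTheory GRing.Theory Num.Theory.
Import numFieldNormedType.Exports.
Local Open Scope classical_set_scope.
Local Open Scope ring_scope.

Section Plane.
Context {R : realType}.
Implicit Types (p q u w z : R * R) (h t : R).

Definition half_plane : set (R * R) := [set z | 0 <= z.2].

Definition unit_disc : set (R * R) := [set z | z.1 ^+ 2 + z.2 ^+ 2 <= 1].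

Definition translate z h u : R * R := (z.1 + h * u.1, z.2 + h * u.2).

Definition unit_vector h : R * R := (cos h, sin h).

Definition det2 u w : R := u.1 * w.2 - u.2 * w.1.

Definition lerp p q t : R * R :=
  ((1 - t) * p.1 + t * q.1, (1 - t) * p.2 + t * q.2).

(* The model triangle; its corners 0, 1, 2 are in anticlockwise order, and
   indices of corners are added in the cyclic group 'I_3. *)
Definition triangle : set (R * R) :=
  [set z | [/\ 0 <= z.1, 0 <= z.2 & z.1 + z.2 <= 1]].

Definition open_triangle : set (R * R) :=
  [set z | [/\ 0 < z.1, 0 < z.2 & z.1 + z.2 < 1]].

Definition corner (i : 'I_3) : R * R :=
  ((i == 1%N :> nat)%:R, (i == 2%N :> nat)%:R).

(* Edge i goes from corner i to corner i + 1. *)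
Definition edge_pt (i : 'I_3) t : R * R := lerp (corner i) (corner (i + 1)) t.

(* Barycentric coordinates with respect to corners i, i + 1, i - 1. *)
Definition bary (i : 'I_3) (a b c : R) : R * R :=
  (a * (corner i).1 + b * (corner (i + 1)).1 + c * (corner (i - 1)).1,
   a * (corner i).2 + b * (corner (i + 1)).2 + c * (corner (i - 1)).2).

(* The segment parallel to edge i, from the point of edge i - 1 at distance eps
   from corner i to the point of edge i + 1 at distance eps from corner i + 1.
   It is drawn as a polygonal line q0 q1 q2 q3, which is straight when neither
   end is slid.  The boolean sb (resp. eb) says that the start (resp. the end)
   is slid to corner i (resp. i + 1); this moves only q0 (resp. q3), and the
   crossings with the two other segments all lie strictly between q1 and q2. *)
Definition segment (eps : R) (sb eb : bool) (i : 'I_3) t : R * R :=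
  let q0 := if sb then bary i 1 0 0 else bary i (1 - eps) 0 eps in
  let q1 := bary i (1 - 3 / 2 * eps) (eps / 2) eps in
  let q2 := bary i (eps / 2) (1 - 3 / 2 * eps) eps in
  let q3 := if eb then bary i 0 1 0 else bary i 0 (1 - eps) eps in
  if t <= 1 / 3 then lerp q0 q1 (3 * t)
  else if t <= 2 / 3 then lerp q1 q2 (3 * t - 1)
  else lerp q2 q3 (3 * t - 2).

End Plane.

Section Surfaces.
Context {R : realType} {X : topologicalType}.

Record chart := Chart { dom : set X ; chart_map :> X -> R * R }.

(* A homeomorphism from an open subset of X onto a relatively open subset of
   the closed upper half-plane. *)
Definition is_chart (c : chart) : Prop :=
  [/\ open (dom c),
      {in dom c &, injective c},
      {in dom c, forall x, {for x, continuous c}} &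
      forall W : set X, open W -> W `<=` dom c ->
        exists2 V : set (R * R), open V & c @` W = V `&` half_plane].

(* The transition from c to c' preserves the orientation at interior points:
   it sends every small anticlockwise circle around c x to a loop l with winding
   number + 1 around c' x (theta is a continuous determination of the angle). *)
Definition co_oriented (c c' : chart) : Prop :=
  forall x, dom c x -> dom c' x -> 0 < (c x).2 -> 0 < (c' x).2 ->
  \forall r \near (0 : R)^'+,
  exists (l : R -> X) (rho theta : R -> R),
    [/\ continuous theta, theta (2 * pi) = theta 0 + 2 * pi &
        forall t, [/\ dom c (l t), dom c' (l t),
          c (l t) = translate (c x) r (unit_vector t), 0 < rho t &
          c' (l t) = translate (c' x) (rho t) (unit_vector (theta t))]].

Definition boundary (A : set chart) : set X :=
  [set x | exists c, [/\ A c, dom c x & (c x).2 = 0]].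

Definition is_disc : Prop :=
  exists (f : X -> R * R) (g : R * R -> X),
    [/\ continuous f, {within unit_disc, continuous g}, cancel f g &
        range f = unit_disc].

(* The a-th boundary component is a circle parametrized by R modulo
   nmarked a, in such a way that its marked points are the images of the
   integers.  In a chart to the upper half-plane, the surface lies on the right
   of a boundary curve iff the first coordinate decreases along the curve. *)
Record marked_surface := MarkedSurface {
  atlas : set chart ;
  ncomp : nat ;
  nmarked : 'I_ncomp -> nat ;
  bd : 'I_ncomp -> R -> X ;
  surface_hausdorff : hausdorff_space X ;
  atlas_chart : forall c, atlas c -> is_chart c ;
  atlas_cover : forall x, exists2 c, atlas c & dom c x ;
  atlas_oriented : forall c c', atlas c -> atlas c' -> co_oriented c c' ;
  ncomp_gt0 : (0 < ncomp)%N ;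
  nmarked_gt0 : forall a, (0 < nmarked a)%N ;
  bd_continuous : forall a, continuous (bd a) ;
  bd_periodic : forall a t, bd a (t + (nmarked a)%:R) = bd a t ;
  bd_inj : forall a a' t t', bd a t = bd a' t' ->
    a = a' /\ exists k : int, t = t' + k%:~R * (nmarked a)%:R ;
  bd_boundary : forall x, boundary atlas x <-> exists a t, bd a t = x ;
  bd_right : forall c a t, atlas c -> dom c (bd a t) ->
    \forall s \near t,
      (s < t -> (c (bd a t)).1 < (c (bd a s)).1) /\
      (t < s -> (c (bd a s)).1 < (c (bd a t)).1) ;
  not_small_disc : ~ (is_disc /\ (\sum_(a < ncomp) nmarked a <= 2)%N)
}.

Definition marked_pt (S : marked_surface) (a : 'I_(ncomp S)) (j : nat) : X :=
  bd a j%:R.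

Definition marked (S : marked_surface) : set X :=
  [set x | exists a j, x = @marked_pt S a j].

Definition positive_chart (S : marked_surface) (c : chart) : Prop :=
  is_chart c /\ forall c', @atlas S c' -> co_oriented c c'.

End Surfaces.
Arguments chart : clear implicits.
Arguments marked_surface : clear implicits.

Section Diagrams.
Context {R : realType} {X : topologicalType} (S : marked_surface R X).
(* A directed curve is given by a map R -> X, of which only the restriction to
   [0, 1] is meaningful. *)
Implicit Types (g d : R -> X) (D : set (R -> X)).

(* At the interior point g s = d t, in some positively oriented chart both
   curves are straight, and d goes to the left of g. *)
Definition interior_crosses_rl g (s : R) d (t : R) : Prop :=
  exists (c : chart R X) (u w : R * R),
    [/\ positive_chart S c, dom c (g s), 0 < det2 u w &
        \forall h \near (0 : R),
          [/\ dom c (g (s + h)), c (g (s + h)) = translate (c (g s)) h u,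
              dom c (d (t + h)) & c (d (t + h)) = translate (c (d t)) h w]].

(* d ends, and g starts, at the marked point p; near p, the final part of d and
   the boundary curve b (which leaves p at time 0) are on the same side of the
   initial part of g. *)
Definition end_on_side g d (b : R -> X) : Prop :=
  \forall e \near (0 : R)^'+, forall U, nbhs (g 0) U ->
  exists C : set X,
    [/\ connected C, C `<=` U `\` (g @` `[0, e]),
        C `&` d @` `]1 - e, 1[ !=set0 & C `&` b @` `]0, e[ !=set0].

(* As the surface is on the right of its boundary, the boundary just before
   p_{a,j} is on the right of a curve starting at p_{a,j}, and the boundary just
   after p_{a,j} is on its left. *)
Definition end_right_of_start g d : Prop :=
  exists a j, g 0 = @marked_pt R X S a j /\
    end_on_side g d (fun h => bd a (j%:R - h)).

Definition end_left_of_start g d : Prop :=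
  exists a j, g 0 = @marked_pt R X S a j /\
    end_on_side g d (fun h => bd a (j%:R + h)).

(* d, at time t, crosses g, at time s, from right to left.  At a marked point,
   d is ending and g is starting, or conversely. *)
Definition crosses_rl g (s : R) d (t : R) : Prop :=
  [\/ [/\ 0 < s < 1, 0 < t < 1 & interior_crosses_rl g s d t],
      [/\ s = 0, t = 1 & end_right_of_start g d] |
      [/\ s = 1, t = 0 & end_left_of_start d g]].

Definition crosses_lr g (s : R) d (t : R) : Prop := crosses_rl d t g s.

Definition passes D g (s : R) (x : X) : Prop :=
  [/\ D g, 0 <= s <= 1 & g s = x].

(* d at time t meets g at time s; g and d may be the same strand at distinct
   times, and d may be the strand ending (starting) at the marked point where
   g starts (ends). *)
Definition meets D g (s : R) d (t : R) : Prop :=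
  [/\ passes D g s (g s), passes D d t (g s) & (g, s) <> (d, t)].

Definition crossing_pt D : set X :=
  [set x | exists g s d t, g s = x /\ meets D g s d t].

Record weak_postnikov D : Prop := WeakPostnikov {
  strand_continuous : forall g, D g -> {within `[0, 1], continuous g} ;
  strand_ends : forall g, D g -> exists a i j,
    g 0 = @marked_pt R X S a i /\ g 1 = @marked_pt R X S a j ;
  unique_start : forall x, marked S x -> exists! g, D g /\ g 0 = x ;
  unique_end : forall x, marked S x -> exists! g, D g /\ g 1 = x ;
  at_most_two : forall x g1 s1 g2 s2 g3 s3,
    passes D g1 s1 x -> passes D g2 s2 x -> passes D g3 s3 x ->
    [\/ (g1, s1) = (g2, s2), (g1, s1) = (g3, s3) | (g2, s2) = (g3, s3)] ;
  transverse : forall g s d t, meets D g s d t ->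
    crosses_rl g s d t \/ crosses_lr g s d t ;
  finite_crossings : finite_set (crossing_pt D) ;
  alternating : forall g s s' d t d' t', s < s' ->
    meets D g s d t -> meets D g s' d' t' ->
    (forall s'' d'' t'', s < s'' < s' -> ~ meets D g s'' d'' t'') ->
    (crosses_lr g s d t /\ crosses_rl g s' d' t') \/
    (crosses_rl g s d t /\ crosses_lr g s' d' t')
}.

Definition has_degree D (k : nat) : Prop :=
  forall g a j, D g -> g 0 = @marked_pt R X S a j -> g 1 = marked_pt a (j + k).

End Diagrams.

Section Triangulations.
Context {R : realType} {X : topologicalType} (S : marked_surface R X).

(* The triangles are images of the model triangle under orientation-preserving
   maps, so that their corners are in anticlockwise order.  An edge (f, i) is a
   boundary interval if mate (f, i) = None, and otherwise is the internal arc it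
   shares with mate (f, i); as all triangles are oriented, the two parametrizations
   of an internal arc are opposite, and a boundary edge is run backwards with
   respect to the numbering of the marked points.  Two corners may be the same
   marked point. *)
Record triangulation := Triangulation {
  tri : finType ;
  tmap : tri -> R * R -> X ;
  mate : tri * 'I_3 -> option (tri * 'I_3) ;
  tmap_continuous : forall f, {within triangle, continuous (tmap f)} ;
  tmap_cover : forall x, exists f z, triangle z /\ tmap f z = x ;
  tmap_interior : forall f, exists c : chart R X,
    [/\ positive_chart S c, dom c = tmap f @` open_triangle &
        forall z, open_triangle z -> c (tmap f z) = z] ;
  tmap_corner : forall f i, marked S (tmap f (corner i)) ;
  mate_sym : forall e e', mate e = Some e' -> mate e' = Some e ;
  mate_neq : forall e, mate e <> Some e ;
  internal_edge : forall f i f' i', mate (f, i) = Some (f', i') ->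
    forall t, 0 <= t <= 1 ->
      tmap f (edge_pt i t) = tmap f' (edge_pt i' (1 - t)) ;
  boundary_edge : forall f i, mate (f, i) = None ->
    exists (a : 'I_(ncomp S)) (j : nat), forall t, 0 <= t <= 1 ->
      tmap f (edge_pt i t) = bd a (j%:R + 1 - t) ;
  boundary_interval : forall (a : 'I_(ncomp S)) (j : nat),
    exists f i, mate (f, i) = None /\ forall t, 0 <= t <= 1 ->
      tmap f (edge_pt i t) = bd a (j%:R + 1 - t) ;
  tmap_inj : forall f z f' z', triangle z -> triangle z' ->
    tmap f z = tmap f' z' ->
    [\/ (f, z) = (f', z'),
        exists i i' t, [/\ mate (f, i) = Some (f', i'), 0 <= t <= 1,
          z = edge_pt i t & z' = edge_pt i' (1 - t)] |
        exists i i', z = corner i /\ z' = corner i']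
}.

Variable T : triangulation.

(* (f, i) stands for the segment of f parallel to edge i. *)
Definition seg : finType := (tri T * 'I_3)%type.

Definition starts_on_boundary (x : seg) : bool := mate (x.1, x.2 - 1) == None.

Definition ends_on_boundary (x : seg) : bool := mate (x.1, x.2 + 1) == None.

(* x ends on edge x.2 + 1 of its triangle, close to corner x.2 + 1, at the point
   where the segment y with y.2 - 1 = i' starts if that edge is glued to (f', i'). *)
Definition followed_by (x y : seg) : bool :=
  mate (x.1, x.2 + 1) == Some (y.1, y.2 - 1).

(* The maximal sequences of segments that can be joined: those going from
   boundary to boundary, and those closing up (with all the choices of a base
   point; a strand of the latter kind would violate strand_ends). *)
Definition is_strand (x : seg) (s : seq seg) : bool :=
  [&& starts_on_boundary x, path followed_by x s & ends_on_boundary (last x s)]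
  || (uniq (x :: s) && cycle followed_by (x :: s)).

Definition seg_curve (eps : R) (x : seg) (t : R) : X :=
  tmap x.1 (segment eps (starts_on_boundary x) (ends_on_boundary x) x.2 t).

(* The k-th segment of x :: s is run in the time interval [k / n, (k + 1) / n],
   where n is the length of x :: s. *)
Definition join (eps : R) (x : seg) (s : seq seg) (t : R) : X :=
  let n := (size s).+1 in
  let k := minn (Num.truncn (n%:R * t)) (size s) in
  seg_curve eps (nth x (x :: s) k) (n%:R * t - k%:R).

Definition strand_diagram (eps : R) : set (R -> X) :=
  [set g | exists x s, is_strand x s /\ g = join eps x s].

End Triangulations.

(* Main.v *)
(* The segments of a strand are opposite to a fixed marked point p: consecutive
   ones lie in adjacent triangles of the fan around p.  As p is on the boundary,
   a small punctured neighbourhood of p is connected, so all the corners at p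
   form a single fan, which goes from the boundary interval before p to the one
   after p; hence no strand closes up, and the strand around p_{a,j+1} goes
   from p_{a,j} to p_{a,j+2}.  In each triangle a strand first crosses segment
   i - 1 and then segment i + 1, in opposite directions, and crossings between
   distinct triangles only happen at marked points; this gives alternation. *)

Require Import Defs.
From HB Require Import structures.
From mathcomp Require Import all_boot all_order all_algebra.
From mathcomp Require Import all_classical all_reals all_analysis.
From mathcomp Require Import ring lra.
Set Implicit Arguments.
Unset Strict Implicit.
Unset Printing Implicit Defensive.
Import Order.TTheory GRing.Theory Num.Theory.
Import numFieldNormedType.Exports.
Local Open Scope classical_set_scope.
Local Open Scope ring_scope.

(** * The model triangle *)

(** The obstacle is that the gluing data constrain edges but not corners: [tmap_inj] lets any two
    corners be the same point, so no combinatorial argument bounds the number of fans at a marked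
    point. The topology of [X] has to enter, and it enters only there, through a boundary chart;
    after that, strands are orbits of the partial injection [followed_by]. All metric work is done
    in barycentric coordinates of the model triangle. The middle third of segment i is the part of
    the line where coordinate i - 1 equals [eps], so two segments cross where two coordinates are
    [eps] and the third is [1 - 2 * eps]. The bound [eps < 1 / 3] says [eps < 1 - 2 * eps]: on each
    segment the two crossings are distinct and come in a fixed order. Sliding bends only the outer
    thirds, hence crossings inside a triangle are straight in its chart. At a marked point the two
    strands may leave through different triangles, so no common straight model is available and
    sides are compared by connected sets. *)

Lemma I3_cases (i j : 'I_3) : [\/ j = i, j = i + 1 | j = i - 1].
Proof.
have : [|| j == i, j == i + 1 | j == i - 1].
  by rewrite -!val_eqE; move: i j; do 2 case=> [[|[|[|//]]]] ?.
by case/or3P => /eqP; [constructor 1 | constructor 2 | constructor 3].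
Qed.

Lemma I3_addr2 (i : 'I_3) : i + 1 + 1 = i - 1.
Proof. by apply/val_inj; move: i; case=> [[|[|[|//]]]] ?. Qed.

Lemma I3_subr2 (i : 'I_3) : i - 1 - 1 = i + 1.
Proof. by apply/val_inj; move: i; case=> [[|[|[|//]]]] ?. Qed.

Lemma I3_neq_addr (i : 'I_3) : (i == i + 1) = false.
Proof. by rewrite -val_eqE; move: i; case=> [[|[|[|//]]]] ?. Qed.

Lemma I3_neq_subr (i : 'I_3) : (i == i - 1) = false.
Proof. by rewrite -val_eqE; move: i; case=> [[|[|[|//]]]] ?. Qed.

Lemma I3_addr_neq (i : 'I_3) : (i + 1 == i) = false.
Proof. by rewrite eq_sym I3_neq_addr. Qed.

Lemma I3_subr_neq (i : 'I_3) : (i - 1 == i) = false.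
Proof. by rewrite eq_sym I3_neq_subr. Qed.

Lemma I3_addr_subr (i : 'I_3) : (i + 1 == i - 1) = false.
Proof. by rewrite -val_eqE; move: i; case=> [[|[|[|//]]]] ?. Qed.

Lemma I3_subr_addr (i : 'I_3) : (i - 1 == i + 1) = false.
Proof. by rewrite eq_sym I3_addr_subr. Qed.

Definition I3E := (I3_addr2, I3_subr2, addrK, subrK, eqxx, I3_neq_addr,
  I3_neq_subr, I3_addr_neq, I3_subr_neq, I3_addr_subr, I3_subr_addr).

Section ModelTriangle.
Context {R : realType}.
Implicit Types (p q z : R * R) (i j k : 'I_3) (t u : R).

(** Barycentric coordinates make the three corners interchangeable: each later argument is relative
    to one index i, with the other two written i + 1 and i - 1. *)
Definition bcoord k z : R := [:: 1 - z.1 - z.2; z.1; z.2]`_k.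

Lemma true_natr : true%:R = 1 :> R. Proof. by []. Qed.

Lemma false_natr : false%:R = 0 :> R. Proof. by []. Qed.

Definition bcoordE :=
  (I3E, true_natr, false_natr, mulr1, mulr0, addr0, add0r).

Lemma bcoord_sum k z : bcoord k z + bcoord (k + 1) z + bcoord (k - 1) z = 1.
Proof. by rewrite /bcoord; case: k => [[|[|[|//]]]] ? /=; ring. Qed.

Lemma bcoord_corner k i : bcoord k (corner i) = (k == i)%:R.
Proof.
rewrite /bcoord /corner -val_eqE.
by move: k i; do 2 case=> [[|[|[|//]]]] ? /=; ring.
Qed.

Lemma bcoord_lerp k p q t :
  bcoord k (lerp p q t) = (1 - t) * bcoord k p + t * bcoord k q.
Proof. by rewrite /bcoord /lerp; case: k => [[|[|[|//]]]] ? /=; ring. Qed.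

Lemma bcoord_bary k i a b c : a + b + c = 1 :> R ->
  bcoord k (bary i a b c) =
  a * (k == i)%:R + b * (k == i + 1)%:R + c * (k == i - 1)%:R.
Proof.
move=> abc; have -> : c = 1 - a - b by rewrite -abc; ring.
rewrite -!bcoord_corner /bary /bcoord.
by case: k => [[|[|[|//]]]] ? /=; ring.
Qed.

Lemma bcoord_edge k i t :
  bcoord k (edge_pt i t) = (1 - t) * (k == i)%:R + t * (k == i + 1)%:R.
Proof. by rewrite /edge_pt bcoord_lerp !bcoord_corner. Qed.

Lemma bcoord_inj z z' : (forall k, bcoord k z = bcoord k z') -> z = z'.
Proof.
move=> h; have := h 1; have := h (1 + 1); rewrite /bcoord /=.
by case: z z' {h} => [a b] [a' b'] /= -> ->.
Qed.

Lemma bcoord_inj2 i z z' :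
  bcoord (i + 1) z = bcoord (i + 1) z' ->
  bcoord (i - 1) z = bcoord (i - 1) z' -> z = z'.
Proof.
move=> h1 h2; apply: bcoord_inj => k.
have [->|->|->//] := I3_cases i k => //.
by have := bcoord_sum i z; rewrite -(bcoord_sum i z') h1 h2 => /addIr/addIr.
Qed.

Lemma triangleP z : triangle z <-> forall k, 0 <= bcoord k z.
Proof.
split=> [[z1 z2 z12] [[|[|[|//]]]] ?|h]; rewrite /bcoord /=; [lra|lra|lra|].
have := h 0; have := h 1; have := h (1 + 1).
by rewrite /bcoord /= => h0 h1 h2; split; lra.
Qed.

Lemma open_triangleP z : open_triangle z <-> forall k, 0 < bcoord k z.
Proof.
split=> [[z1 z2 z12] [[|[|[|//]]]] ?|h]; rewrite /bcoord /=; [lra|lra|lra|].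
have := h 0; have := h 1; have := h (1 + 1).
by rewrite /bcoord /= => h0 h1 h2; split; lra.
Qed.

Lemma triangleP3 i z : triangle z <->
  [/\ 0 <= bcoord i z, 0 <= bcoord (i + 1) z & 0 <= bcoord (i - 1) z].
Proof.
rewrite triangleP; split=> [h|[h1 h2 h3] k]; first by split.
by have [->|->|->] := I3_cases i k.
Qed.

Lemma open_triangleP3 i z : open_triangle z <->
  [/\ 0 < bcoord i z, 0 < bcoord (i + 1) z & 0 < bcoord (i - 1) z].
Proof.
rewrite open_triangleP; split=> [h|[h1 h2 h3] k]; first by split.
by have [->|->|->] := I3_cases i k.
Qed.

Lemma edge_triangle i t : 0 <= t <= 1 -> triangle (edge_pt i t).
Proof.
move=> /andP[t0 t1]; apply/(triangleP3 i).
by rewrite !bcoord_edge !bcoordE; split; lra.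
Qed.

Lemma edge_pt0 i : edge_pt i 0 = corner i :> R * R.
Proof. by apply: bcoord_inj => k; rewrite bcoord_edge bcoord_corner; ring. Qed.

Lemma edge_pt1 i : edge_pt i 1 = corner (i + 1) :> R * R.
Proof. by apply: bcoord_inj => k; rewrite bcoord_edge bcoord_corner; ring. Qed.

Lemma corner_triangle i : triangle (corner i : R * R).
Proof. by rewrite -edge_pt0; apply: edge_triangle; lra. Qed.

Lemma edge_pt_inj i j t u : 0 < t < 1 ->
  edge_pt i t = edge_pt j u -> i = j /\ t = u.
Proof.
move=> /andP[t0 t1] e.
have := congr1 (bcoord i) e; have := congr1 (bcoord (i + 1)) e.
have := congr1 (bcoord (i - 1)) e.
by have [->|->|->] := I3_cases i j; rewrite !bcoord_edge !bcoordE;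
  move=> *; (exfalso; lra) || (split=> //; lra).
Qed.

Lemma edge_pt_corner i j t : edge_pt i t = corner j -> t = 0 \/ t = 1.
Proof.
move=> e.
have := congr1 (bcoord i) e; have := congr1 (bcoord (i + 1)) e.
by have [->|->|->] := I3_cases i j; rewrite !bcoord_edge !bcoord_corner !bcoordE;
  move=> *; (left; lra) || (right; lra) || (exfalso; lra).
Qed.

End ModelTriangle.

(** * The three segments of a triangle and their crossings *)

Section Segments.
Context {R : realType}.
Variables (eps : R) (eps_gt0 : 0 < eps) (eps_lt : eps < 1 / 3).
Implicit Types (i : 'I_3) (t u : R) (sb eb : bool).

(** On each piece the two coordinates are chosen so that sliding affects only the coordinate i - 1:
    the start has coordinate i + 1 equal to 0, and the end has coordinate i equal to 0, slid or
    not. *)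
Lemma segment_coord sb eb i t (z := segment eps sb eb i t) :
  [\/ [/\ t <= 1 / 3, bcoord (i + 1) z = eps * t * (3 / 2) &
          bcoord (i - 1) z = if sb then eps * t * 3 else eps],
      [/\ 1 / 3 < t, t <= 2 / 3,
          bcoord (i + 1) z = eps / 2 + (3 * t - 1) * (1 - 2 * eps) &
          bcoord (i - 1) z = eps] |
      [/\ 2 / 3 < t, bcoord i z = eps * (1 - t) * (3 / 2) &
          bcoord (i - 1) z = if eb then eps * (1 - t) * 3 else eps]].
Proof.
rewrite {}/z /segment; case: leP => t1; last case: leP => t2.
- by constructor 1; split=> //; case: sb;
    rewrite bcoord_lerp !bcoord_bary ?bcoordE; field.
- by constructor 2; split=> //; rewrite bcoord_lerp !bcoord_bary ?bcoordE; field.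
- by constructor 3; split=> //; case: eb;
    rewrite bcoord_lerp !bcoord_bary ?bcoordE; field.
Qed.

Lemma segment0 sb eb i :
  segment eps sb eb i 0 = if sb then corner i else edge_pt (i - 1) (1 - eps).
Proof.
by apply: (@bcoord_inj2 _ i); have [[_ h1 h2]|[]|[]] := segment_coord sb eb i 0;
  (try lra); rewrite ?h1 ?h2 {h1 h2};
  case: sb; rewrite ?bcoord_corner ?bcoord_edge !bcoordE; ring.
Qed.

Lemma segment1 sb eb i :
  segment eps sb eb i 1 = if eb then corner (i + 1) else edge_pt (i + 1) eps.
Proof.
have h := bcoord_sum i (segment eps sb eb i 1).
by apply: (@bcoord_inj2 _ i); move: h;
  have [[]|[]|[_ h1 h2]] := segment_coord sb eb i 1; (try lra);
  move: h1 h2; case: eb; rewrite ?bcoord_corner ?bcoord_edge !bcoordE; lra.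
Qed.

Lemma segment_open sb eb i t :
  0 < t < 1 -> open_triangle (segment eps sb eb i t).
Proof.
have [e0 e1] := (eps_gt0, eps_lt).
move=> /andP[t0 t1]; apply/(open_triangleP3 i).
have := bcoord_sum i (segment eps sb eb i t).
have et0 : 0 < eps * t by rewrite mulr_gt0.
have et1 : 0 < eps * (1 - t) by rewrite mulr_gt0// subr_gt0.
have [[ht -> ->]|[ht ht' -> ->]|[ht -> ->]] := segment_coord sb eb i t.
- have : eps * t <= eps * (1 / 3) by rewrite ler_pM2l.
  by case: sb => /= *; split; lra.
- have : 0 < (3 * t - 1) * (1 - 2 * eps) by apply: mulr_gt0; lra.
  have : 0 <= (2 - 3 * t) * (1 - 2 * eps) by apply: mulr_ge0; lra.
  by move=> *; split; lra.
- have : eps * (1 - t) <= eps * (1 / 3) by rewrite ler_pM2l//; lra.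
  by case: eb => /= *; split; lra.
Qed.

Lemma segment_triangle sb eb i t :
  0 <= t <= 1 -> triangle (segment eps sb eb i t).
Proof.
have [e0 e1] := (eps_gt0, eps_lt).
move=> /andP[]; rewrite le_eqVlt => /predU1P[<- _|t0].
  rewrite segment0; case: sb; first exact: corner_triangle.
  by apply: edge_triangle; lra.
rewrite le_eqVlt => /predU1P[->|t1].
  rewrite segment1; case: eb; first exact: corner_triangle.
  by apply: edge_triangle; lra.
apply/triangleP => k; apply/ltW; move: k.
by apply/open_triangleP/segment_open; rewrite t0.
Qed.

(** Strict growth of one coordinate makes the polygonal line embedded, whatever ends are slid. *)
Lemma segment_coord_lt sb eb i t u : 0 <= t -> t < u -> u <= 1 ->
  bcoord (i + 1) (segment eps sb eb i t) < bcoord (i + 1) (segment eps sb eb i u).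
Proof.
have [e0 e1] := (eps_gt0, eps_lt).
move=> t0 tu u1.
have := bcoord_sum i (segment eps sb eb i t).
have := bcoord_sum i (segment eps sb eb i u).
have et : 0 <= eps * t by apply: mulr_ge0; lra.
have eu : 0 <= eps * (1 - u) by apply: mulr_ge0; lra.
have etu : 0 < eps * (u - t) by apply: mulr_gt0; lra.
have tu' : 0 < (1 - 2 * eps) * (u - t) by apply: mulr_gt0; lra.
have [[ht -> ->]|[ht ht' -> ->]|[ht -> ->]] := segment_coord sb eb i t;
have [[hu -> ->]|[hu hu' -> ->]|[hu -> ->]] := segment_coord sb eb i u; try lra.
- have : 0 < (1 - 2 * eps) * (3 * u - 1) by apply: mulr_gt0; lra.
  have : eps * t <= eps * (1 / 3) by rewrite ler_pM2l.
  lra.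
- have : eps * t <= eps * (1 / 3) by rewrite ler_pM2l.
  have : eps * (1 - u) <= eps * (1 / 3) by rewrite ler_pM2l//; lra.
  by case: eb => /=; lra.
- have : 0 <= (1 - 2 * eps) * (2 - 3 * t) by apply: mulr_ge0; lra.
  have : eps * (1 - u) < eps * (1 / 3) by rewrite ltr_pM2l//; lra.
  by case: eb => /=; lra.
- by case: eb => /=; lra.
Qed.

Lemma segment_inj sb eb i t u : 0 <= t <= 1 -> 0 <= u <= 1 ->
  segment eps sb eb i t = segment eps sb eb i u -> t = u.
Proof.
have [e0 e1] := (eps_gt0, eps_lt).
move=> /andP[t0 t1] /andP[u0 u1] /(congr1 (bcoord (i + 1))) e.
have [tu|tu|//] := ltgtP t u.
- by have := segment_coord_lt sb eb i t0 tu u1; rewrite e ltxx.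
- by have := segment_coord_lt sb eb i u0 tu t1; rewrite e ltxx.
Qed.

(* On segment i, the crossing with segment i - 1 comes at time cross_in, and the
   crossing with segment i + 1 at time cross_out. *)
Definition cross_in : R := (1 + eps / (2 * (1 - 2 * eps))) / 3.
Definition cross_out : R := 1 - cross_in.

Lemma cross_in_itv : 1 / 3 < cross_in < 1 / 2.
Proof.
have [e0 e1] := (eps_gt0, eps_lt).
have d : 0 < 2 * (1 - 2 * eps) by lra.
have : 0 < eps / (2 * (1 - 2 * eps)) by rewrite divr_gt0.
have : eps / (2 * (1 - 2 * eps)) < 1 / 2 by rewrite ltr_pdivrMr//; lra.
by rewrite /cross_in => *; apply/andP; split; lra.
Qed.

(** The equation that determines [cross_in]: on the middle piece, coordinate i + 1 rises from
    [eps / 2] and reaches [eps], the level of segment i - 1. *)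
Lemma cross_inE : (3 * cross_in - 1) * (1 - 2 * eps) = eps / 2.
Proof.
have [e0 e1] := (eps_gt0, eps_lt).
by rewrite /cross_in; field; apply/negP => /eqP; lra.
Qed.

Lemma segment_cross_in sb eb i : segment eps sb eb i cross_in =
  bary i (1 - 2 * eps) eps eps.
Proof.
have /andP[c1 c2] := cross_in_itv; have e := cross_inE.
by apply: (@bcoord_inj2 _ i);
  have [[]|[_ _ h1 h2]|[]] := segment_coord sb eb i cross_in; try lra;
  rewrite ?h1 ?h2 ?bcoord_bary ?bcoordE; lra.
Qed.

Lemma segment_cross_out sb eb i : segment eps sb eb i cross_out =
  bary i eps (1 - 2 * eps) eps.
Proof.
have [e0 e1] := (eps_gt0, eps_lt).
have /andP[c1 c2] := cross_in_itv; have := cross_inE.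
by rewrite -[cross_in](subKr 1) -/cross_out => e; apply: (@bcoord_inj2 _ i);
  have [[]|[_ _ h1 h2]|[]] := segment_coord sb eb i cross_out;
  rewrite ?h1 ?h2 ?bcoord_bary ?bcoordE /cross_out; try lra;
  move: e; rewrite /cross_out; lra.
Qed.

Lemma segment_cross sb eb sb' eb' i :
  segment eps sb eb i cross_out = segment eps sb' eb' (i + 1) cross_in.
Proof.
rewrite segment_cross_out segment_cross_in.
by apply: (@bcoord_inj2 _ i); rewrite !bcoord_bary ?bcoordE; lra.
Qed.

(** Two distinct indices modulo 3 are consecutive in one of the two orders, so this settles every
    pair of segments in a triangle. Of the nine pairs of pieces, only middle with middle and last
    with first can meet. *)
Lemma segment_meet_next sb eb sb' eb' i t u : 0 <= t <= 1 -> 0 <= u <= 1 ->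
  segment eps sb eb i t = segment eps sb' eb' (i + 1) u ->
  (t = cross_out /\ u = cross_in) \/ [/\ t = 1, u = 0, eb & sb'].
Proof.
have [e0 e1] := (eps_gt0, eps_lt).
move=> t01 u01 e.
have /andP[t0 t1] := t01; have /andP[u0 u1] := u01.
have [z Ez] : exists z, z = segment eps sb eb i t by exists (segment eps sb eb i t).
have := bcoord_sum i z.
have := segment_coord sb' eb' (i + 1) u; rewrite -e -Ez !I3E.
have et : 0 <= eps * t by apply: mulr_ge0; lra.
have eu : 0 <= eps * u by apply: mulr_ge0; lra.
have et' : 0 <= eps * (1 - t) by apply: mulr_ge0; lra.
have eu' : 0 <= eps * (1 - u) by apply: mulr_ge0; lra.
have tC : 1 - t = 0 -> t = 1 by lra.
have := segment_coord sb eb i t.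
rewrite -Ez => -[[ht h1 h2]|[ht ht' h1 h2]|[ht h1 h2]];
case=> [[hu p q]|[hu hu' p q]|[hu p q]] s.
- exfalso; have : eps * t <= eps * (1 / 3) by rewrite ler_pM2l.
  have : eps * u <= eps * (1 / 3) by rewrite ler_pM2l.
  by case: (sb) h2; case: (sb') q => /=; lra.
- exfalso; have : eps * t <= eps * (1 / 3) by rewrite ler_pM2l.
  by case: (sb) h2 => /=; lra.
- exfalso; have : eps * t <= eps * (1 / 3) by rewrite ler_pM2l.
  have : eps * (1 - u) < eps * (1 / 3) by rewrite ltr_pM2l//; lra.
  by case: (sb) h2; case: (eb') q => /=; lra.
- exfalso; have : eps * u <= eps * (1 / 3) by rewrite ler_pM2l.
  by case: (sb') q => /=; lra.
- left; split.
  + apply: (@segment_inj sb eb i) => //.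
      by have := cross_in_itv; rewrite /cross_out; lra.
    rewrite -Ez segment_cross_out; apply: (@bcoord_inj2 _ i);
      by rewrite ?bcoord_bary ?bcoordE; lra.
  + apply: (@segment_inj sb' eb' (i + 1)) => //.
      by have := cross_in_itv; lra.
    rewrite -e -Ez segment_cross_in; apply: (@bcoord_inj2 _ i);
      by rewrite ?bcoord_bary ?bcoordE; lra.
- exfalso; have : eps * (1 - u) < eps * (1 / 3) by rewrite ltr_pM2l//; lra.
  by case: (eb') q => /=; lra.
(* Last piece against first piece. If both ends are slid, the coordinates give [1 - t = 2 * u] and
   [u = 2 * (1 - t)], so both vanish; otherwise a coordinate equal to [eps] would be at most
   [eps / 2]. *)
- have h3 : eps * (1 - t) < eps * (1 / 3) by rewrite ltr_pM2l//; lra.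
  have h4 : eps * u <= eps * (1 / 3) by rewrite ler_pM2l//.
  case: (eb) h2; case: (sb') q => /= q h2; [right|exfalso..]; try lra.
  have : eps * (1 - t) = 0 by lra.
  have : eps * u = 0 by lra.
  by move=> /eqP; rewrite mulf_eq0 gt_eqF//= => /eqP -> /eqP;
    rewrite mulf_eq0 gt_eqF//= => /eqP /tC ->.
- exfalso; have : eps * (1 - t) < eps * (1 / 3) by rewrite ltr_pM2l//; lra.
  by case: (eb) h2 => /=; lra.
- exfalso; have : eps * (1 - t) < eps * (1 / 3) by rewrite ltr_pM2l//; lra.
  have : eps * (1 - u) < eps * (1 / 3) by rewrite ltr_pM2l//; lra.
  by case: (eb) h2; case: (eb') q => /=; lra.
Qed.

End Segments.

Lemma small_pos (R : realFieldType) (d e : R) : 0 < d -> 0 < e ->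
  exists t, [/\ 0 < t, t < d & t < e].
Proof.
by move=> d0 e0; have [de|de] := ltP d e; [exists (d / 2)|exists (e / 2)];
  split; lra.
Qed.

(** * Connected and closed subsets of the plane *)

Section PlaneTopology.
Context {R : realType}.
Implicit Types (p q z : R * R) (A P : set (R * R)).

Lemma lerp_continuous p q : continuous (lerp p q).
Proof.
have h (a b : R) : continuous (fun t : R => (1 - t) * a + t * b).
  move=> t; apply: cvgD; apply: cvgM; try exact: cvg_cst; try exact: cvg_id.
  by apply: cvgB; [exact: cvg_cst|exact: cvg_id].
move=> t.
exact: (@cvg_pair _ _ _ _ (nbhs _) (nbhs _) _ _ _ _ _
  (h p.1 q.1 t) (h p.2 q.2 t)).
Qed.

Lemma lerp0 p q : lerp p q 0 = p.
Proof. by rewrite /lerp !(subr0, mul0r, addr0, mul1r); case: p. Qed.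

Lemma lerp1 p q : lerp p q 1 = q.
Proof. by rewrite /lerp !(subrr, mul0r, add0r, mul1r); case: q. Qed.

Lemma star_shaped_connected A p : A p ->
  (forall z t, A z -> 0 <= t <= 1 -> A (lerp p z t)) -> connected A.
Proof.
move=> Ap h.
have -> : A = \bigcup_(z in A) (lerp p z @` `[0, 1]).
  apply/seteqP; split=> [z Az|_ [z Az [t t01 <-]]].
    exists z => //; exists 1; last exact: lerp1.
    by rewrite /= in_itv /= ler01 lexx.
  by apply: h => //; move: t01; rewrite /= in_itv.
apply: bigcup_connected => [|z Az].
  by exists p => z _; exists 0; [rewrite /= in_itv /= ler01 lexx|exact: lerp0].
apply: connected_continuous_connected; first exact: segment_connected.
exact/continuous_subspaceT/lerp_continuous.
Qed.

(** The puncture lies on the boundary line: a segment issued from [(a, r / 2)] can reach height 0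
    only at its far end, so removing the puncture keeps the set star-shaped. *)
Lemma punctured_half_ball_connected (a r : R) : 0 < r ->
  connected [set z | [/\ `|z.1 - a| < r, 0 <= z.2, z.2 < r & z <> (a, 0)]].
Proof.
move=> r0; apply: (@star_shaped_connected _ (a, r / 2)) => /=.
  rewrite subrr normr0; split=> //; [lra|lra|].
  by move=> -[]; lra.
move=> [x y] t [/= xa y0 yr xy] /andP[t0 t1]; rewrite /lerp /=.
have hr : 0 <= (1 - t) * r by apply: mulr_ge0; lra.
have hy : 0 <= t * y by apply: mulr_ge0; lra.
have hyr : 0 <= t * (r - y) by apply: mulr_ge0; lra.
split; last 1 first.
- move=> [e1 e2].
  have : (1 - t) * r = 0 by lra.
  move/eqP; rewrite mulf_eq0 (gt_eqF r0) orbF => /eqP h.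
  have t1' : t = 1 by lra.
  by apply: xy; congr (_, _); move: e1 e2; rewrite t1'; lra.
- have -> : (1 - t) * a + t * x - a = t * (x - a) by ring.
  rewrite normrM ger0_norm//; apply: le_lt_trans xa.
  by rewrite ler_piMl.
- lra.
- have : 0 < r - y by lra.
  have [->|t1'] := eqVneq t 1; first lra.
  have : 0 < (1 - t) * r by apply: mulr_gt0 => //; lra.
  lra.
Qed.

Lemma bcoord_continuous k : continuous (bcoord k : R * R -> R).
Proof.
have c1 : continuous (fst : R * R -> R) by move=> z; exact: cvg_fst.
have c2 : continuous (snd : R * R -> R) by move=> z; exact: cvg_snd.
rewrite /bcoord; case: k => [[|[|[|//]]]] ? /= z; last 2 first.
- exact: c1.
- exact: c2.
by apply: cvgB; [apply: cvgB; [exact: cvg_cst|exact: c1]|exact: c2].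
Qed.

Lemma closed_bcoord_ge k (a : R) : closed [set z | a <= bcoord k z].
Proof.
apply: (@preimage_closed _ _ (bcoord k) [set x | a <= x]); last exact: closed_ge.
by move=> z _; exact: bcoord_continuous.
Qed.

Lemma closed_bcoord_le k (a : R) : closed [set z | bcoord k z <= a].
Proof.
apply: (@preimage_closed _ _ (bcoord k) [set x | x <= a]); last exact: closed_le.
by move=> z _; exact: bcoord_continuous.
Qed.

Lemma triangle_compact : compact (triangle : set (R * R)).
Proof.
have c01 : compact (`[0, 1]%classic `*` `[0, 1]%classic : set (R * R)).
  by apply: compact_setX; exact: segment_compact.
apply: (subclosed_compact _ c01) => [|z []]; last first.
  by rewrite /= !in_itv /= => *; split; apply/andP; split; lra.
have -> : triangle = \bigcap_k [set z | 0 <= bcoord k z] :> set (R * R).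
  apply/seteqP; split=> z; first by move/triangleP => h k _; exact: h.
  by move=> h; apply/triangleP => k; exact: h.
by apply: closed_bigI => k _; exact: closed_bcoord_ge.
Qed.

Lemma bcoord_two_large (i j : 'I_3) z : triangle z ->
  1 / 2 < bcoord i z -> 1 / 2 < bcoord j z -> i = j.
Proof.
move=> /(triangleP3 i)[z1 z2 z3]; have := bcoord_sum i z.
by have [->|->|->] := I3_cases i j => // *; exfalso; lra.
Qed.

End PlaneTopology.

(** * Fans of triangles around marked points *)

Section TriangulationTopology.
Context {R : realType} {X : topologicalType} {S : marked_surface R X}.
Variable T : triangulation S.
Implicit Types (f : tri T) (i k : 'I_3) (x y : seg T) (t u : R).

Lemma closed_tmap f (P : set (R * R)) :
  closed P -> closed (tmap f @` (triangle `&` P)).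
Proof.
move=> cP; apply: compact_closed; first exact: surface_hausdorff S.
apply: continuous_compact; last exact: compact_closedI triangle_compact cP.
have := @tmap_continuous _ _ _ T f; apply: continuous_subspaceW.
exact: subIsetl.
Qed.

Lemma tmap_eq_corner f z f' i : triangle z ->
  tmap f z = tmap f' (corner i) -> exists k, z = corner k.
Proof.
move=> tz /(tmap_inj tz (corner_triangle i))[[_ ->]| |[k [_ [-> _]]]].
- by exists i.
- move=> [k [k' [t [_ _ -> /esym/edge_pt_corner e]]]].
  have [->|->] : t = 1 \/ t = 0 by case: e; [left|right]; lra.
    by exists (k + 1); exact: edge_pt1.
  by exists k; exact: edge_pt0.
- by exists k.
Qed.

(** Through this map [seg T] also indexes the corners of all triangles: [x] stands for the corner
    facing edge [x.2], and a set of segments can be read as a set of corners. *)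
Definition fan_vertex x : X := tmap x.1 (corner (x.2 - 1)).

Lemma tmap_near_corner f i (U : set X) : nbhs (tmap f (corner i)) U ->
  exists2 d : R, 0 < d &
    forall z, triangle z -> 1 - d < bcoord i z -> U (tmap f z).
Proof.
move=> nU; have := @tmap_continuous _ _ _ T f.
move=> /subspace_continuousP /(_ _ (corner_triangle i)) /(_ _ nU).
move=> /nbhs_ballP[d /= d0 dU]; exists d => // z tz zd.
apply: dU => //; move: tz zd => [z1 z2 z12].
rewrite /bcoord /corner.
by case: i {nU} => [[|[|[|//]]]] ? /= h; split; rewrite /ball /= ltr_norml;
  apply/andP; split; lra.
Qed.

Lemma followed_byP x y :
  reflect (mate (x.1, x.2 + 1) = Some (y.1, y.2 - 1)) (followed_by x y).
Proof. exact: eqP. Qed.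

Lemma followed_by_fan_vertex x y : followed_by x y -> fan_vertex x = fan_vertex y.
Proof.
move/followed_byP/internal_edge => /(_ 1); rewrite subrr edge_pt0 edge_pt1 !I3E.
by apply; rewrite ler01 lexx.
Qed.

(* Otherwise a small punctured half-disc around the common vertex would be
   disconnected by the corners in K and the other corners at that vertex. *)
Lemma fan_unique (K : set (seg T)) (p : X) y y0 :
  (forall x x', followed_by x x' -> K x <-> K x') ->
  (forall x, K x -> fan_vertex x = p) ->
  K y -> fan_vertex y0 = p -> K y0.
Proof.
move=> Kf Kp Ky y0p; apply: contrapT => Ky0.
(* Any threshold strictly between 1/2 and 1 would do: above 1/2, a point is big for at most one
   corner of its triangle; below 1, the corners stay out of the closed set [F]. *)
pose big x : set (R * R) := [set z | 2 / 3 <= bcoord (x.2 - 1) z].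
pose Q x := tmap x.1 @` (triangle `&` big x).
pose A := \bigcup_(x in K) Q x; pose B := \bigcup_(x in ~` K) Q x.
pose small : set (R * R) := [set z | forall k, bcoord k z <= 2 / 3].
pose F := \bigcup_(f in [set: tri T]) (tmap f @` (triangle `&` small)).
have cQ x : closed (Q x) by apply/closed_tmap/closed_bcoord_ge.
have cA : closed A by apply: closed_bigcup => //; exact: finite_finset.
have cB : closed B by apply: closed_bigcup => //; exact: finite_finset.
have cF : closed F.
  apply: closed_bigcup => [|f _]; first exact: finite_finset.
  apply: closed_tmap.
  have -> : small = \bigcap_k [set z | bcoord k z <= 2 / 3].
    by apply/seteqP; split=> z h k; [move=> _; exact: h|exact: h k I].
  by apply: closed_bigI => k _; exact: closed_bcoord_le.
have half : 1 / 2 < 2 / 3 :> R by lra.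
have nhalf : ~ (2 / 3 <= 0 :> R) by apply/negP; rewrite -ltNge; lra.
have FAB v : ~ F v -> A v \/ B v.
  move=> nFv; have [f [z [tz zv]]] := @tmap_cover _ _ _ T v.
  have [k zk] : exists k, 2 / 3 <= bcoord k z.
    apply: contrapT => /forallNP h; apply: nFv.
    exists f => //; exists z => //; split=> // k.
    by have := h k; case: leP => // /ltW.
  have Qv : Q (f, k + 1) v by exists z => //; split; rewrite /big //= I3E.
  by have [] := pselect (K (f, k + 1)); [left|right]; exists (f, k + 1).
have Fp : ~ F p.
  move=> [f _ [z [tz zs] zp]]; move: zp; rewrite -y0p => /tmap_eq_corner.
  move=> /(_ tz)[k zk]; have := zs k; rewrite zk bcoord_corner !bcoordE; lra.
(* Away from corners, regions of two different corners meet only along a glued edge near a common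
   end; the two corners are then consecutive in the fan, against the invariance of [K]. *)
have ABp v : A v -> B v -> v = p.
  move=> [x Kx [z [tz xz] zv]] [x' Kx' [z' [tz' xz'] zv']].
  move: (zv); rewrite -zv' => /(tmap_inj tz tz')[[ff zz]| |[k [k' [zk zk']]]].
  - case: Kx'; rewrite (_ : x' = x)//.
    move: xz xz'; rewrite /big /= -zz => xz xz'.
    have e := bcoord_two_large tz (lt_le_trans half xz) (lt_le_trans half xz').
    by case: x x' ff e {Kx xz zv xz' zv'} => [f i] [f' i'] /= -> /addIr ->.
  - move=> [k [k' [t [e /andP[t0 t1] zk zk']]]].
    move: xz; rewrite /big /= zk bcoord_edge => xz.
    move: xz'; rewrite /big /= zk' bcoord_edge => xz'.
    exfalso; have [xk|xk|xk] := I3_cases k (x.2 - 1); last 1 first.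
    + by move: xz; rewrite xk !bcoordE; lra.
    + have [xk'|xk'|xk'] := I3_cases k' (x'.2 - 1).
      * by move: xz xz'; rewrite xk xk' !bcoordE; lra.
      * case: Kx'; apply/(Kf x' x) => //; apply/followed_byP.
        by apply: mate_sym; rewrite -(I3_subr2 x'.2) xk' addrK xk.
      * by move: xz'; rewrite xk' !bcoordE; lra.
    + have [xk'|xk'|xk'] := I3_cases k' (x'.2 - 1).
      * case: Kx'; apply/(Kf x x') => //; apply/followed_byP.
        by rewrite -(I3_subr2 x.2) xk addrK xk'.
      * by move: xz xz'; rewrite xk xk' !bcoordE; lra.
      * by move: xz'; rewrite xk' !bcoordE; lra.
  - rewrite -(Kp _ Kx) zv' -zv zk /fan_vertex; congr tmap; congr corner.
    move: xz; rewrite /big /= zk bcoord_corner.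
    by case: eqP => [->//|_]; rewrite false_natr => /nhalf.
have [a [j pE]] : marked S p by rewrite -y0p; exact: tmap_corner.
have /(bd_boundary S)[c [ac dp cp0]] : exists a t, @bd _ _ S a t = p.
  by exists a, j%:R.
have [oc cinj ccont copen] := atlas_chart ac.
pose W := dom c `&` ~` F.
have oW : open W by apply: openI => //; exact: closed_openC.
have [V oV VE] := copen W oW (@subIsetl _ _ _).
have oWA : open (W `&` ~` A) by apply: openI => //; exact: closed_openC.
have oWB : open (W `&` ~` B) by apply: openI => //; exact: closed_openC.
have [VA oVA VAE] := copen _ oWA (fun v h => h.1.1).
have [VB oVB VBE] := copen _ oWB (fun v h => h.1.1).
have Vp : V (c p) by have [] : (V `&` half_plane) (c p) by rewrite -VE; exists p.
have [r /= r0 rV] : nbhs_ball (c p) V.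
  by apply/nbhs_ballP; apply: open_nbhs_nbhs.
have cpE : c p = ((c p).1, 0) by rewrite -cp0; case: (c p).
pose E : set (R * R) :=
  [set z | [/\ `|z.1 - (c p).1| < r, 0 <= z.2, z.2 < r & z <> ((c p).1, 0)]].
have EW z : E z -> exists v, [/\ W v, v <> p & c v = z].
  move=> [z1 z2 z2r zp].
  have : (V `&` half_plane) z.
    split=> //; apply: rV; split; rewrite /ball /=.
      by rewrite distrC.
    by rewrite cp0 sub0r normrN ger0_norm.
  rewrite -VE => -[v Wv vz]; exists v; split=> // vp.
  by apply: zp; rewrite -vz vp.
(* The chart turns the open complements of [A] and [B] into open sets [VA] and [VB] of the plane,
   which will split the punctured half-ball [E] into two disjoint parts. *)
have EVA v : W v -> VA (c v) <-> ~ A v.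
  move=> Wv; split=> [cv|nAv].
    have : (VA `&` half_plane) (c v).
      split=> //; have [] : (V `&` half_plane) (c v) by rewrite -VE; exists v.
      by [].
    rewrite -VAE => -[v' [[Wv' _] nAv'] e].
    by rewrite -(cinj v' v) ?inE//; case: Wv.
  by have [] : (VA `&` half_plane) (c v) by rewrite -VAE; exists v.
have EVB v : W v -> VB (c v) <-> ~ B v.
  move=> Wv; split=> [cv|nBv].
    have : (VB `&` half_plane) (c v).
      split=> //; have [] : (V `&` half_plane) (c v) by rewrite -VE; exists v.
      by [].
    rewrite -VBE => -[v' [[Wv' _] nBv'] e].
    by rewrite -(cinj v' v) ?inE//; case: Wv.
  by have [] : (VB `&` half_plane) (c v) by rewrite -VBE; exists v.
have EVAB z : E z -> VA z <-> ~ VB z.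
  move=> /EW[v [Wv vp <-]]; rewrite (EVA v Wv) (EVB v Wv); split.
    by move=> nAv nnB; have [] := FAB v Wv.2.
  by move=> nnB Av; apply: nnB => Bv; apply: vp; exact: ABp.
(* Each corner at [p] is seen inside [E], by a point of an adjacent edge close to [p]. Hence both
   parts of [E] are nonempty. *)
have Qp x : fan_vertex x = p -> exists v, [/\ W v, v <> p, Q x v & E (c v)].
  move=> xp; set i := x.2 - 1.
  have Wp : nbhs (tmap x.1 (corner i)) (W `&` (c @^-1` ball (c p) r)).
    have -> : tmap x.1 (corner i) = p by [].
    apply: filterI; first by apply: open_nbhs_nbhs; split=> //; split.
    by apply: ccont; [rewrite inE|exact: nbhsx_ballx].
  have [d d0 dW] := tmap_near_corner Wp.
  have [t [t0 td t1]] : exists t, [/\ 0 < t, t < d & t < 1 / 3].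
    by apply: small_pos => //; lra.
  have tt : triangle (edge_pt i t) by apply: edge_triangle; lra.
  have [Wv cv] : (W `&` (c @^-1` ball (c p) r)) (tmap x.1 (edge_pt i t)).
    by apply: dW => //; rewrite bcoord_edge !bcoordE; lra.
  have vp : tmap x.1 (edge_pt i t) <> p.
    rewrite -xp => /(tmap_eq_corner tt)[k /edge_pt_corner]; lra.
  exists (tmap x.1 (edge_pt i t)); split=> //.
    exists (edge_pt i t) => //; split=> //.
    by rewrite /big /= bcoord_edge !bcoordE; lra.
  have [_ c0] : (V `&` half_plane) (c (tmap x.1 (edge_pt i t))).
    by rewrite -VE; exists (tmap x.1 (edge_pt i t)).
  move: cv => [/= cv1 cv2]; rewrite /ball /= in cv1 cv2.
  split=> //; first by rewrite distrC.
    by move: cv2; rewrite cp0 sub0r normrN; apply: le_lt_trans; exact: ler_norm.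
  by rewrite -cpE => /cinj; rewrite !inE => /(_ Wv.1 dp).
have conE : connected E by exact: punctured_half_ball_connected.
have [vA [WA vAp QA EA]] := Qp y (Kp _ Ky).
have [vB [WB vBp QB EB]] := Qp y0 y0p.
have AvA : A vA by exists y.
have BvB : B vB by exists y0.
(* [E] minus [VA] is [E] inside [VB], so this part is open and closed in [E]; connectedness makes it
   everything, yet it misses the image of [vA]. *)
have : E `<=` E `&` VA.
  rewrite (conE (E `&` VA)) //.
  - exists (c vB); split=> //; apply/(EVA _ WB) => AvB; apply: vBp; exact: ABp.
  - by exists VA.
  - exists (~` VB); first exact: open_closedC.
    by apply/seteqP; split=> z [Ez h]; split=> //; apply/EVAB.
by move=> /(_ _ EA)[_ /(EVA _ WA)].
Qed.

End TriangulationTopology.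

(** * Combinatorics of strands *)

Section Strands.
Context {R : realType} {X : topologicalType} {S : marked_surface R X}.
Variable T : triangulation S.
Implicit Types (f : tri T) (i : 'I_3) (x y z : seg T) (s : seq (seg T)).
Local Notation follows := (@followed_by _ _ _ T).

Lemma bd_periodicz (a : 'I_(ncomp S)) (t : R) (k : int) :
  bd a (t + k%:~R * (nmarked a)%:R) = bd a t.
Proof.
have pos (n : nat) u : bd a (u + n%:R * (nmarked a)%:R) = bd a u.
  elim: n u => [|n IHn] u; first by rewrite mul0r addr0.
  by rewrite -natr1 mulrDl mul1r addrA bd_periodic.
case: k => n; first exact: pos.
by rewrite NegzE mulrNz mulNr -(pos n.+1) subrK.
Qed.

(** Both edges follow the same parametrization up to whole turns of the boundary circle, so
    agreement at one common time propagates to the midpoint, which is no corner and lies on no glued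
    edge. *)
Lemma boundary_edge_inj f i f' i' (t : R) :
  mate (f, i) = None -> mate (f', i') = None -> 0 <= t <= 1 ->
  tmap f (edge_pt i t) = tmap f' (edge_pt i' t) -> (f, i) = (f', i').
Proof.
move=> m m' t01; have [a [j e]] := boundary_edge m.
have [a' [j' e']] := boundary_edge m'.
rewrite e// e'// => /bd_inj[aa [k jk]]; subst a'.
have hh : 0 < (1 / 2 : R) < 1 by lra.
have h01 : 0 <= (1 / 2 : R) <= 1 by lra.
have : tmap f (edge_pt i (1 / 2)) = tmap f' (edge_pt i' (1 / 2)).
  rewrite e// e'// -[RHS](bd_periodicz _ _ k); congr bd.
  by move: jk; set c := _ * _ => jk; lra.
have [it it'] := (@edge_triangle R i _ h01, @edge_triangle R i' _ h01).
case/(tmap_inj it it').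
- by move=> h; move: (congr1 fst h) (congr1 snd h) => /= -> /(edge_pt_inj hh)[->].
- move=> [k1 [k2 [u [mk _ /(edge_pt_inj hh)[ik _] _]]]].
  by rewrite -ik m in mk.
- by move=> [k1 [k2 [/edge_pt_corner h _]]]; exfalso; move: h => []; lra.
Qed.

Lemma seg_eq x y i : (x.1, x.2 + i) = (y.1, y.2 + i) -> x = y.
Proof.
move=> e; have := congr1 fst e; have /addIr := congr1 snd e.
by case: x y {e} => [f k] [f' k'] /= -> ->.
Qed.

Lemma followed_by_fun x y z : followed_by x y -> followed_by x z -> y = z.
Proof.
by move=> /followed_byP e /followed_byP; rewrite e => /Some_inj/seg_eq.
Qed.

Lemma followed_by_inj x y z : followed_by x z -> followed_by y z -> x = y.
Proof.
move=> /followed_byP/mate_sym e /followed_byP/mate_sym; rewrite e.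
by move=> /Some_inj/seg_eq.
Qed.

Lemma starts_no_pred x y : starts_on_boundary y -> ~~ followed_by x y.
Proof.
move=> /eqP m; apply/negP => /followed_byP/mate_sym; by rewrite m.
Qed.

Lemma ends_no_succ x y : ends_on_boundary x -> ~~ followed_by x y.
Proof. by move=> /eqP m; apply/negP => /followed_byP; rewrite m. Qed.

Lemma fan_start x :
  exists2 y : seg T, starts_on_boundary y & fan_vertex y = fan_vertex x.
Proof.
have [a [j vx]] := tmap_corner x.1 (x.2 - 1).
(* This index is j - 1 modulo [nmarked a], kept in [nat]: the interval just before the vertex. As
   the edge runs backwards, the vertex is its corner i. *)
have [f [i [m e]]] := boundary_interval T a (j + (nmarked a).-1).
exists (f, i + 1); first by rewrite /starts_on_boundary /= addrK m.
rewrite /fan_vertex /= addrK vx -edge_pt0 e ?lexx ?ler01// subr0 /marked_pt.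
rewrite -[RHS]bd_periodic; congr bd.
by rewrite natr1 -addnS prednK ?nmarked_gt0// natrD.
Qed.

Lemma fan_end x : exists2 y : seg T, ends_on_boundary y & fan_vertex y = fan_vertex x.
Proof.
have [a [j vx]] := tmap_corner x.1 (x.2 - 1).
have [f [i [m e]]] := boundary_interval T a j.
exists (f, i - 1); first by rewrite /ends_on_boundary /= subrK m.
rewrite /fan_vertex /= I3_subr2 vx -edge_pt1 e ?lexx ?ler01//.
by rewrite addrK.
Qed.

Lemma path_fan_vertex x s :
  path follows x s -> fan_vertex (last x s) = fan_vertex x.
Proof. by elim: s x => //= y s IHs x /andP[/followed_by_fan_vertex -> /IHs]. Qed.

(** As [followed_by] is a partial injection, the forward and backward orbits of [x] together are
    stable under successors and predecessors, which is what [fan_unique] asks of [K]. *)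
Lemma fan_connect x y : fan_vertex x = fan_vertex y ->
  connect follows x y \/ connect follows y x.
Proof.
move=> xy; pose K := [set z | connect follows x z \/ connect follows z x].
apply: (@fan_unique _ _ _ _ K (fan_vertex x) x y) => /=; last 2 first.
- by left.
- exact: esym.
- move=> u v uv; rewrite /K /=; split=> -[].
  + by move=> xu; left; apply: connect_trans xu (connect1 uv).
  + move=> /connectP[[|w p] /=]; first by move=> _ ->; left; exact: connect1.
    move=> /andP[uw wp] ->; right; rewrite -(followed_by_fun uw uv).
    by apply/connectP; exists p.
  + move=> /connectP[p]; case/lastP: p => [|p w] /=.
      by move=> _ vx; right; rewrite -vx; exact: connect1.
    rewrite rcons_path last_rcons => /andP[xp pw] vw; left.
    by apply/connectP; exists p => //; move: pw; rewrite -vw => /(followed_by_inj uv).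
  + by move=> vx; right; apply: connect_trans (connect1 uv) vx.
- by move=> z [] /connectP[p /path_fan_vertex e ep]; rewrite ep e.
Qed.

(** No termination argument is needed: the fan contains a starting segment, comparable with [x], and
    having no predecessor it can be reached from [x] only if it is [x]. *)
Lemma connect_start x : exists2 y : seg T, starts_on_boundary y & connect follows y x.
Proof.
have [y sy /fan_connect[]] := fan_start x; first by exists y.
move=> /connectP[p]; case/lastP: p => [|p w] /=; first by move=> _ <-; exists y.
rewrite rcons_path last_rcons => /andP[_ pw] yw.
by have := starts_no_pred (last x p) sy; rewrite yw pw.
Qed.

Lemma connect_end x : exists2 y : seg T, ends_on_boundary y & connect follows x y.
Proof.
have [y ey /fan_connect[]] := fan_end x; last by exists y.
move=> /connectP[[|w p] /=]; first by move=> _ ->; exists y.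
by move=> /andP[yw _]; have := ends_no_succ w ey; rewrite yw.
Qed.

Definition open_strand x s : bool :=
  [&& starts_on_boundary x, path follows x s & ends_on_boundary (last x s)].

(** A cycle is stable under successors, so it would contain the ending segment reached from [x],
    which has no successor. *)
Lemma is_strandE x s : is_strand x s = open_strand x s.
Proof.
rewrite /is_strand -/(open_strand x s) orb_idr//.
move=> /andP[_ c]; have [y ey /connectP[p xp yp]] := connect_end x.
have yc : y \in x :: s.
  have closed_cycle q v : v \in x :: s -> path follows v q -> last v q \in x :: s.
    elim: q v => //= u q IHq v vc /andP[vu uq]; apply: IHq => //.
    by rewrite -(followed_by_fun (next_cycle c vc) vu) mem_next.
  by rewrite yp closed_cycle// mem_head.
by have := ends_no_succ (next (x :: s) y) ey; rewrite (next_cycle c yc).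
Qed.

Lemma strand_through x : exists y s (k : nat),
  [/\ open_strand y s, (k <= size s)%N & nth y (y :: s) k = x].
Proof.
have [y sy /connectP[p yp xp]] := connect_start x.
have [z ez /connectP[q xq zq]] := connect_end x.
exists y, (p ++ q), (size p); split; last 1 first.
- by rewrite -cat_cons nth_cat /= ltnSn -last_nth.
- by rewrite /open_strand sy cat_path yp -xp xq last_cat -xp -zq.
- by rewrite size_cat leq_addr.
Qed.

Lemma strand_step x s k : open_strand x s -> (k < size s)%N ->
  followed_by (nth x (x :: s) k) (nth x (x :: s) k.+1).
Proof. by move=> /and3P[_ /(pathP x) h _] /h. Qed.

Lemma starts_at_head x s k : open_strand x s -> (k <= size s)%N ->
  starts_on_boundary (nth x (x :: s) k) -> k = 0%N.
Proof.
case: k => // k sp ks /(starts_no_pred (nth x (x :: s) k)).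
by rewrite strand_step.
Qed.

Lemma ends_at_last x s k : open_strand x s -> (k <= size s)%N ->
  ends_on_boundary (nth x (x :: s) k) -> k = size s.
Proof.
move=> sp; rewrite leq_eqVlt => /predU1P[//|ks].
by move=> /(ends_no_succ (nth x (x :: s) k.+1)); rewrite strand_step.
Qed.

Lemma strand_det x s s' : open_strand x s -> open_strand x s' -> s = s'.
Proof.
move=> /and3P[_ xs ls] /and3P[_ xs' ls'].
elim: s s' x xs xs' ls ls' => [|y s IHs] [|y' s'] x //=.
- by move=> _ /andP[xy _] /(ends_no_succ y'); rewrite xy.
- by move=> /andP[xy _] _ _ /(ends_no_succ y); rewrite xy.
- move=> /andP[xy ys] /andP[xy' ys'] ls ls'.
  have e := followed_by_fun xy xy'; subst y'.
  by congr cons; exact: IHs ys ys' ls ls'.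
Qed.

(** Going backwards from a common segment is deterministic, and both strands must run out of
    predecessors at the same step. So each segment occurs once in the whole diagram. *)
Lemma strand_pos_inj x s k x' s' k' :
  open_strand x s -> open_strand x' s' -> (k <= size s)%N -> (k' <= size s')%N ->
  nth x (x :: s) k = nth x' (x' :: s') k' -> [/\ x = x', s = s' & k = k'].
Proof.
move=> sp sp' ks ks' e.
have [xx kk] : x = x' /\ k = k'.
  elim: k k' ks ks' e => [|k IHk] [|k'] ks ks' e.
  - by split=> //; exact: e.
  - have /and3P[sx _ _] := sp; have := strand_step sp' ks'; rewrite -e /=.
    by rewrite (negPf (starts_no_pred _ sx)).
  - have /and3P[sx _ _] := sp'; have := strand_step sp ks; rewrite e /=.
    by rewrite (negPf (starts_no_pred _ sx)).
  - have := strand_step sp ks; rewrite e => /followed_by_inj.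
    move=> /(_ _ (strand_step sp' ks')).
    by case/(IHk _ (ltnW ks) (ltnW ks')) => -> ->.
subst x'; split=> //; exact: strand_det sp sp'.
Qed.

End Strands.

(** * Strands as curves *)

Section StrandCurves.
Context {R : realType} {X : topologicalType} {S : marked_surface R X}.
Variables (T : triangulation S) (eps : R).
Hypotheses (eps_gt0 : 0 < eps) (eps_lt : eps < 1 / 3).
Implicit Types (f : tri T) (i : 'I_3) (x y z : seg T) (s : seq (seg T)).
Implicit Types (t u h : R) (k : nat).

Definition model_curve x t : R * R :=
  segment eps (starts_on_boundary x) (ends_on_boundary x) x.2 t.

Lemma seg_curveE x t : seg_curve eps x t = tmap x.1 (model_curve x t).
Proof. by []. Qed.

Definition slid_end x t : Prop :=
  (t = 0 /\ starts_on_boundary x) \/ (t = 1 /\ ends_on_boundary x).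

Definition glued_end x t : Prop :=
  (t = 0 /\ model_curve x t = edge_pt (x.2 - 1) (1 - eps)) \/
  (t = 1 /\ model_curve x t = edge_pt (x.2 + 1) eps).

Lemma model_curve_triangle x t : 0 <= t <= 1 -> triangle (model_curve x t).
Proof. exact: segment_triangle. Qed.

Lemma model_curve_cases x t : 0 <= t <= 1 ->
  [\/ 0 < t < 1 /\ open_triangle (model_curve x t),
      slid_end x t /\ (exists i, model_curve x t = corner i) | glued_end x t].
Proof.
move=> /andP[]; rewrite le_eqVlt => /predU1P[<- _|t0].
  rewrite /glued_end /slid_end /model_curve segment0.
  by case: ifP => b; [constructor 2; split; [left|exists x.2]|constructor 3; left].
rewrite le_eqVlt => /predU1P[->|t1].
  rewrite /glued_end /slid_end /model_curve segment1.
  by case: ifP => b;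
    [constructor 2; split; [right|exists (x.2 + 1)]|constructor 3; right].
by constructor 1; split; [apply/andP|apply: segment_open => //; apply/andP].
Qed.

Lemma open_triangle_edge i t : ~ open_triangle (edge_pt i t : R * R).
Proof.
by move=> /open_triangleP/(_ (i - 1)); rewrite bcoord_edge !bcoordE ltxx.
Qed.

Lemma open_triangle_corner i : ~ open_triangle (corner i : R * R).
Proof. by rewrite -edge_pt0; exact: open_triangle_edge. Qed.

Lemma glued_end_corner x t i : glued_end x t -> model_curve x t <> corner i.
Proof.
by have [e0 e1] := (eps_gt0, eps_lt); move=> [[_ ->]|[_ ->]] /edge_pt_corner h;
  exfalso; move: h => [] h; lra.
Qed.

Lemma slid_corner x t i : 0 <= t <= 1 -> model_curve x t = corner i -> slid_end x t.
Proof.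
move=> t01 e; case: (model_curve_cases x t01).
- by rewrite e => -[_ /open_triangle_corner].
- by case.
- by move/glued_end_corner/(_ e).
Qed.

(** Starts sit at parameter [1 - eps] of their edge and ends at [eps], while gluing reverses the
    parameter; as [eps] is not 1/2, an end can only be glued to a start. *)
Lemma glued_end_followed x y t u i i' v :
  glued_end x t -> glued_end y u -> mate (x.1, i) = Some (y.1, i') ->
  model_curve x t = edge_pt i v -> model_curve y u = edge_pt i' (1 - v) ->
  [/\ followed_by x y, t = 1 & u = 0] \/ [/\ followed_by y x, t = 0 & u = 1].
Proof.
have [e0 e1] := (eps_gt0, eps_lt).
have h1 : 0 < eps < 1 by lra.
have h2 : 0 < 1 - eps < 1 by lra.
move=> [[-> ->]|[-> ->]] [[-> ->]|[-> ->]] m.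
- by move=> /(edge_pt_inj h2)[_ <-] /(edge_pt_inj h2)[_]; lra.
- move=> /(edge_pt_inj h2)[xi _] /(edge_pt_inj h1)[yi _]; right; split=> //.
  by apply/followed_byP/mate_sym; rewrite xi yi.
- move=> /(edge_pt_inj h1)[xi _] /(edge_pt_inj h2)[yi _]; left; split=> //.
  by apply/followed_byP; rewrite xi yi.
- by move=> /(edge_pt_inj h1)[_ <-] /(edge_pt_inj h1)[_]; lra.
Qed.

(** Points of distinct triangles are identified only on edges, and a segment touches edges only at
    its ends: either at a corner, after sliding, or at a glued end. Within one triangle, the planar
    analysis applies. *)
Lemma seg_curve_eq x t y u : 0 <= t <= 1 -> 0 <= u <= 1 ->
  seg_curve eps x t = seg_curve eps y u ->
  [\/ x = y /\ t = u,
      [/\ followed_by x y, t = 1 & u = 0] \/ [/\ followed_by y x, t = 0 & u = 1],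
      [/\ y = (x.1, x.2 + 1), t = cross_out eps & u = cross_in eps] \/
      [/\ x = (y.1, y.2 + 1), t = cross_in eps & u = cross_out eps] |
      slid_end x t /\ slid_end y u].
Proof.
move=> t01 u01; rewrite !seg_curveE.
have [tx ty] := (model_curve_triangle x t01, model_curve_triangle y u01).
case/(tmap_inj tx ty) => [e| |[i [i' [xi yi]]]]; last first.
- by constructor 4; split; [apply: slid_corner xi|apply: slid_corner yi].
- move=> [i [i' [v [m v01 xi yi]]]].
  have [[_]|[sx [k xk]]|gx] := model_curve_cases x t01.
  + by rewrite xi => /open_triangle_edge.
  + constructor 4; split=> //.
    have /edge_pt_corner vv : edge_pt i v = corner k by rewrite -xi.
    have [k' yk'] : exists k' : 'I_3, model_curve y u = corner k'.
      rewrite yi; case: vv => ->; [exists (i' + 1)|exists i'].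
        by rewrite subr0 edge_pt1.
      by rewrite subrr edge_pt0.
    exact: slid_corner yk'.
  + have [[_]|[sy [k yk]]|gy] := model_curve_cases y u01.
    * by rewrite yi => /open_triangle_edge.
    * have /edge_pt_corner vv : edge_pt i' (1 - v) = corner k by rewrite -yi.
      exfalso.
      have [v0|v0] : v = 0 \/ v = 1 by case: vv => ?; [right|left]; lra.
        by move/glued_end_corner: gx => /(_ i); rewrite xi v0 edge_pt0.
      by move/glued_end_corner: gx => /(_ (i + 1)); rewrite xi v0 edge_pt1.
    * by constructor 2; exact: glued_end_followed gx gy m xi yi.
- have exy : x.1 = y.1 := congr1 fst e.
  have {e} : model_curve x t = model_curve y u := congr1 snd e.
  rewrite /model_curve; have [yx|yx|yx] := I3_cases x.2 y.2.
  + have e : x = y by case: (x) (y) exy yx => [? ?] [? ?] /= -> ->.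
    subst y => /segment_inj h; constructor 1; split=> //; exact: h.
  + rewrite yx => /segment_meet_next[]//.
      by move=> [-> ->]; constructor 3; left; split=> //;
         rewrite exy -yx; case: (y).
    by move=> [-> -> ex sy]; constructor 4; split; [right|left].
  + have xy : x.2 = y.2 + 1 by rewrite yx subrK.
    rewrite xy => /esym/segment_meet_next[]//.
      by move=> [-> ->]; constructor 3; right; split=> //;
         rewrite -exy -xy; case: (x).
    by move=> [-> -> ex sy]; constructor 4; split; [left|right].
Qed.

(** Inverse of the change of time in [join]. A joint has two descriptions, local time 1 on segment k
    and local time 0 on segment k + 1. *)
Definition strand_time s k t : R := (k%:R + t) / (size s).+1%:R.

Lemma strand_time_itv s k t : (k <= size s)%N -> 0 <= t <= 1 ->
  0 <= strand_time s k t <= 1.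
Proof.
move=> ks /andP[t0 t1]; rewrite /strand_time.
rewrite divr_ge0 ?addr_ge0//= ler_pdivrMr// mul1r -natr1 lerD// ler_nat.
by [].
Qed.

Lemma strand_time_onto s t : 0 <= t <= 1 ->
  exists k u, [/\ (k <= size s)%N, 0 <= u <= 1 & t = strand_time s k u].
Proof.
move=> /andP[t0 t1]; pose m := minn (Num.truncn ((size s).+1%:R * t)) (size s).
have nt0 : 0 <= (size s).+1%:R * t by rewrite mulr_ge0.
exists m, ((size s).+1%:R * t - m%:R); split; first by rewrite geq_minr.
- rewrite subr_ge0 lerBlDl natr1 /m.
  have /andP[] := truncn_itv nt0.
  case: leqP => [_ n1 n2|lt n1 _]; first by rewrite n1 ltW.
  rewrite (le_trans _ n1) ?ler_nat 1?ltnW//=.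
  by rewrite ler_piMr.
- by rewrite /strand_time addrC subrK mulrC mulKf.
Qed.

Lemma seg_curve_glue x y : followed_by x y -> seg_curve eps x 1 = seg_curve eps y 0.
Proof.
have [e0 e1] := (eps_gt0, eps_lt).
move=> xy; rewrite /seg_curve segment0 segment1.
have /negPf -> : ~~ ends_on_boundary x.
  by apply/negP => /(ends_no_succ y); rewrite xy.
have /negPf -> : ~~ starts_on_boundary y.
  by apply/negP => /(starts_no_pred x); rewrite xy.
by apply: internal_edge; [exact/followed_byP|lra].
Qed.

Lemma join_at x s k t : open_strand x s -> (k <= size s)%N -> 0 <= t <= 1 ->
  join eps x s (strand_time s k t) = seg_curve eps (nth x (x :: s) k) t.
Proof.
move=> sp ks /andP[t0 t1]; rewrite /join /strand_time mulrC divfK//.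
(* At local time 1 the truncation in [join] already selects segment k + 1, which gives the same
   point by gluing; on the last segment [minn] prevents the overshoot. *)
move: t1; rewrite le_eqVlt => /predU1P[->|t1].
  rewrite natr1 natrK.
  have [ks'|ks'] := ltnP k (size s).
    by rewrite (minn_idPl ks') subrr; exact/esym/seg_curve_glue/strand_step.
  have -> : k = size s by apply/eqP; rewrite eqn_leq ks ks'.
  by rewrite (minn_idPr (leqnSn _)) -natr1 addrC addKr.
rewrite (@truncn_def _ _ k) ?(minn_idPl ks).
  by rewrite [k%:R + t]addrC addrK.
by rewrite -natr1; apply/andP; split; lra.
Qed.

Lemma join0 x s : open_strand x s -> join eps x s 0 = tmap x.1 (corner x.2).
Proof.
move=> sp; have := @join_at x s 0 0 sp (leq0n _).
rewrite /strand_time addr0 mul0r => -> //; last by rewrite lexx ler01.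
by rewrite /seg_curve segment0; case/and3P: sp => ->.
Qed.

Lemma join1 x s : open_strand x s ->
  join eps x s 1 = tmap (last x s).1 (corner ((last x s).2 + 1)).
Proof.
move=> sp; have := @join_at x s (size s) 1 sp (leqnn _).
rewrite /strand_time natr1 divff// => -> //; last by rewrite lexx ler01.
by rewrite /seg_curve segment1 -last_nth; case/and3P: sp => _ _ ->.
Qed.

Lemma strand_eq_start x s x' s' : open_strand x s -> open_strand x' s' ->
  join eps x s 0 = join eps x' s' 0 -> x = x' /\ s = s'.
Proof.
move=> sp sp'; rewrite !join0//.
have [/and3P[/eqP sx _ _] /and3P[/eqP sx' _ _]] := (sp, sp').
rewrite -{1}[x.2](subrK 1) -{1}[x'.2](subrK 1) -!edge_pt1.
move=> /(boundary_edge_inj sx sx'); rewrite lexx ler01 => /(_ isT)/seg_eq e.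
by subst x'; split=> //; exact: strand_det sp sp'.
Qed.

Lemma strand_eq_end x s x' s' : open_strand x s -> open_strand x' s' ->
  join eps x s 1 = join eps x' s' 1 -> x = x' /\ s = s'.
Proof.
move=> sp sp'; rewrite !join1//.
have [/and3P[_ _ /eqP sx] /and3P[_ _ /eqP sx']] := (sp, sp').
rewrite -!edge_pt0.
move=> /(boundary_edge_inj sx sx'); rewrite lexx ler01 => /(_ isT)/seg_eq e.
have [] := @strand_pos_inj _ _ _ _ x s (size s) x' s' (size s') sp sp'.
- by [].
- by [].
- by rewrite -!last_nth.
- by move=> -> ->.
Qed.

(** A joint counts as a single pass, because consecutive segments determine the strand and the
    position. Slid ends occur only at global times 0 and 1, and two strands with the same start, or
    the same end, coincide; so at a marked point a start meets an end. *)
Lemma pass_cases x s k t x' s' k' t'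
    (a := nth x (x :: s) k) (a' := nth x' (x' :: s') k')
    (v := strand_time s k t) (v' := strand_time s' k' t') :
  open_strand x s -> open_strand x' s' -> (k <= size s)%N -> (k' <= size s')%N ->
  0 <= t <= 1 -> 0 <= t' <= 1 ->
  join eps x s v = join eps x' s' v' ->
  [\/ [/\ x = x', s = s' & v = v'],
      [/\ a' = (a.1, a.2 + 1), t = cross_out eps & t' = cross_in eps] \/
      [/\ a = (a'.1, a'.2 + 1), t = cross_in eps & t' = cross_out eps] |
      (v = 0 /\ v' = 1) \/ (v = 1 /\ v' = 0)].
Proof.
move=> sp sp' ks ks' t01 t01' vv; move: (vv).
rewrite !join_at// -/a -/a' => /(seg_curve_eq t01 t01').
have glue y r y' r' n n' : open_strand y r -> open_strand y' r' ->
    (n <= size r)%N -> (n' <= size r')%N ->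
    followed_by (nth y (y :: r) n) (nth y' (y' :: r') n') ->
    [/\ y = y', r = r' & strand_time r n 1 = strand_time r' n' 0].
  move=> sy sy' nr nr' fb.
  have nr1 : (n < size r)%N.
    move: nr; rewrite leq_eqVlt => /predU1P[e|//].
    have /and3P[_ _] := sy => /(ends_no_succ (nth y' (y' :: r') n')).
    by rewrite (last_nth y) -e fb.
  have e := followed_by_fun (strand_step sy nr1) fb.
  have [yy rr nn] := strand_pos_inj sy sy' nr1 nr' e.
  by rewrite yy rr -nn /strand_time natr1 addr0.
have slid y r n u : open_strand y r -> (n <= size r)%N ->
    slid_end (nth y (y :: r) n) u ->
    strand_time r n u = 0 \/ strand_time r n u = 1.
  move=> sy nr [[-> /(starts_at_head sy nr) ->]|[-> /(ends_at_last sy nr) ->]].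
    by left; rewrite /strand_time addr0 mul0r.
  by right; rewrite /strand_time natr1 divff.
case=> [[e tt]|[[fb te te']|[fb te te']]|c|[c c']].
- have [xx ss kk] := strand_pos_inj sp sp' ks ks' e.
  by constructor 1; split=> //; rewrite /v /v' tt ss kk.
- by constructor 1; rewrite /v /v' te te'; exact: glue fb.
- constructor 1; rewrite /v /v' te te'.
  by have [-> -> ->] := glue _ _ _ _ _ _ sp' sp ks' ks fb.
- by constructor 2.
- case: (slid _ _ _ _ sp ks c) (slid _ _ _ _ sp' ks' c') => e [] e'.
  + constructor 1; rewrite /v /v' e e'.
    by move: vv; rewrite /v /v' e e' => /(strand_eq_start sp sp')[-> ->].
  + by constructor 3; left.
  + by constructor 3; right.
  + constructor 1; rewrite /v /v' e e'.
    by move: vv; rewrite /v /v' e e' => /(strand_eq_end sp sp')[-> ->].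
Qed.

Lemma join_inj x s x' s' : open_strand x s -> open_strand x' s' ->
  join eps x s = join eps x' s' -> x = x' /\ s = s'.
Proof. by move=> sp sp' e; apply: strand_eq_start => //; rewrite e. Qed.

End StrandCurves.

(** * Continuity of the strands *)

Section WithinContinuity.

Lemma within_continuous_comp_within (X Y Z : topologicalType) (A : set X) (B : set Y)
    (g : X -> Y) (f : Y -> Z) :
  {within A, continuous g} -> {within B, continuous f} ->
  (forall x, A x -> B (g x)) -> {within A, continuous (f \o g)}.
Proof.
move=> /subspace_continuousP cg /subspace_continuousP cf AB.
apply/subspace_continuousP => x Ax; apply: cvg_comp (cf _ (AB _ Ax)).
move=> P BP; have := cg x Ax _ BP; rewrite /nbhs /= /within /=.
by apply: filterS => y h Ay; apply: h => //; exact: AB.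
Qed.

Lemma within_itv_cat (R : realType) (Y : topologicalType) (g : R -> Y) (a b c : R) :
  a <= b -> b <= c ->
  {within `[a, b], continuous g} -> {within `[b, c], continuous g} ->
  {within `[a, c], continuous g}.
Proof.
move=> ab bc gab gbc.
have -> : `[a, c]%classic = `[a, b] `|` `[b, c] :> set R.
  apply/seteqP; split=> u /=; rewrite !in_itv /=.
    by move=> /andP[au uc]; have [ub|bu] := leP u b; [left|right];
      rewrite ?au ?ub ?uc ?(ltW bu).
  move=> [] /andP[h1 h2]; first by rewrite h1 (le_trans h2 bc).
  by rewrite h2 (le_trans ab h1).
by apply: withinU_continuous => //; exact: itv_closed.
Qed.

Lemma within_eq (X Y : topologicalType) (A : set X) (f g : X -> Y) :
  (forall x, A x -> f x = g x) -> {within A, continuous f} ->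
  {within A, continuous g}.
Proof.
by move=> fg; apply: subspace_eq_continuous => x /set_mem; exact: fg.
Qed.

End WithinContinuity.

Section StrandContinuity.
Context {R : realType} {X : topologicalType} {S : marked_surface R X}.
Variables (T : triangulation S) (eps : R).
Hypotheses (eps_gt0 : 0 < eps) (eps_lt : eps < 1 / 3).
Implicit Types (x : seg T) (s : seq (seg T)).

Lemma affine_continuous (a b : R) : continuous (fun t : R => a * t + b).
Proof.
move=> t; apply: cvgD; last exact: cvg_cst.
by apply: cvgM; [exact: cvg_cst|exact: cvg_id].
Qed.

Lemma segment_continuous sb eb (i : 'I_3) :
  {within `[0, 1], continuous (segment eps sb eb i)}.
Proof.
have piece p q (a b u v : R) :
    (forall t, u <= t <= v -> lerp p q (a * t + b) = segment eps sb eb i t) ->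
    {within `[u, v], continuous (segment eps sb eb i)}.
  move=> e; apply: (@within_eq _ _ _ (lerp p q \o (fun t => a * t + b))).
    by move=> t; rewrite /= in_itv /=; exact: e.
  apply: continuous_subspaceT => t.
  by apply: continuous_comp; [exact: affine_continuous|exact: lerp_continuous].
apply: (@within_itv_cat _ _ _ _ (1 / 3)); [lra|lra| |
  apply: (@within_itv_cat _ _ _ _ (2 / 3)); [lra|lra| |]].
- apply: (piece _ _ 3 0) => t /andP[t0 t1].
  by rewrite addr0 /segment t1.
- apply: (piece _ _ 3 (- 1)) => t /andP[]; rewrite le_eqVlt => /predU1P[<- _|t0 t1].
    rewrite /segment lexx (_ : 3 * (1 / 3) - 1 = 0); last lra.
    by rewrite (_ : 3 * (1 / 3) = 1); [rewrite lerp0 lerp1|lra].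
  by rewrite /segment leNgt t0 /= t1.
- apply: (piece _ _ 3 (- 2)) => t /andP[]; rewrite le_eqVlt => /predU1P[<- _|t0 t1].
    rewrite /segment lexx (_ : 3 * (2 / 3) - 2 = 0); last lra.
    rewrite (_ : 3 * (2 / 3) - 1 = 1); last lra.
    by case: leP => [h|_]; [exfalso; lra|rewrite lerp0 lerp1].
  by rewrite /segment !leNgt t0 /=; case: ltP => // h; exfalso; lra.
Qed.

Lemma join_continuous x s : open_strand x s ->
  {within `[0, 1], continuous (join eps x s)}.
Proof.
move=> sp; set n : R := (size s).+1%:R.
have n0 : 0 < n by [].
have piece k : (k <= size s)%N ->
    {within `[k%:R / n, k.+1%:R / n], continuous (join eps x s)}.
  move=> ks; set y := nth x (x :: s) k.
  apply: (@within_eq _ _ _ ((tmap y.1 \o model_curve eps y) \o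
                            (fun t => n * t + (- k%:R)))).
    move=> t; rewrite /= in_itv /= ler_pdivrMr// ler_pdivlMr// -natr1.
    move=> /andP[t0 t1]; rewrite -seg_curveE -join_at//; last by lra.
    by rewrite /strand_time addrC subrK mulrC mulKf// gt_eqF.
  apply: (@within_continuous_comp_within R R X _ (`[0, 1]%classic : set R)
            (fun t => n * t + (- k%:R)) (tmap y.1 \o model_curve eps y)).
  - exact/continuous_subspaceT/affine_continuous.
  - apply: (@within_continuous_comp_within R (R * R)%type X _ triangle
              (model_curve eps y) (tmap y.1)).
    + exact: segment_continuous.
    + exact: tmap_continuous.
    + move=> t; rewrite /= in_itv /=; exact: model_curve_triangle.
  - move=> t; rewrite /= !in_itv /= ler_pdivrMr// ler_pdivlMr// -natr1.
    by move=> /andP[t0 t1]; lra.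
suff h k : (k <= (size s).+1)%N ->
    {within `[0, k%:R / n], continuous (join eps x s)}.
  by have := h _ (leqnn _); rewrite divff.
elim: k => [_|k IHk ks].
  by rewrite mul0r set_itv1; exact: continuous_subspace1.
apply: within_itv_cat (IHk (ltnW ks)) (piece k ks); first by rewrite divr_ge0.
by rewrite ler_pM2r ?invr_gt0// ler_nat.
Qed.

End StrandContinuity.

(** * Crossings *)

Section Crossings.
Context {R : realType} {X : topologicalType} {S : marked_surface R X}.
Variables (T : triangulation S) (eps : R).
Hypotheses (eps_gt0 : 0 < eps) (eps_lt : eps < 1 / 3).
Implicit Types (x y : seg T) (s : seq (seg T)) (i : 'I_3) (t h n : R).

(** Velocity on the middle piece: 3 is the speed-up of a third of the unit interval, and [n] that of
    a strand made of [n] segments. *)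
Definition seg_velocity n i : R * R :=
  (n * (3 * (1 - 2 * eps) * ((corner (i + 1)).1 - (corner i).1)),
   n * (3 * (1 - 2 * eps) * ((corner (i + 1)).2 - (corner i).2))).

Lemma segment_straight sb eb i t n h :
  1 / 3 < t <= 2 / 3 -> 1 / 3 < t + n * h <= 2 / 3 ->
  segment eps sb eb i (t + n * h) =
  translate (segment eps sb eb i t) h (seg_velocity n i).
Proof.
move=> /andP[t1 t2] /andP[th1 th2].
rewrite /segment !leNgt t1 th1 /= -!leNgt t2 th2.
by rewrite /translate /seg_velocity /lerp /bary /=; congr (_, _); field.
Qed.

Lemma det2_seg_velocity n n' i : 0 < n -> 0 < n' ->
  0 < det2 (seg_velocity n i) (seg_velocity n' (i + 1)).
Proof.
have [e0 e1] := (eps_gt0, eps_lt); move=> n0 n0'.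
have e2 : 0 < 1 - 2 * eps by lra.
(* Consecutive edge vectors of the anticlockwise model triangle have determinant 1, so segment i + 1
   goes to the left of segment i. *)
have -> : det2 (seg_velocity n i) (seg_velocity n' (i + 1)) =
    n * n' * (3 * (1 - 2 * eps)) ^+ 2.
  rewrite /det2 /seg_velocity /corner.
  by case: i => [[|[|[|//]]]] ? /=; ring.
by rewrite mulr_gt0 ?exprn_gt0 ?mulr_gt0.
Qed.

Lemma join_straight x s k t h (c : chart R X) (a := nth x (x :: s) k)
    (n : R := (size s).+1%:R) :
  open_strand x s -> (k <= size s)%N -> 1 / 3 < t <= 2 / 3 ->
  1 / 3 < t + n * h <= 2 / 3 ->
  dom c = tmap a.1 @` open_triangle ->
  (forall z, open_triangle z -> c (tmap a.1 z) = z) ->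
  dom c (join eps x s (strand_time s k t + h)) /\
  c (join eps x s (strand_time s k t + h)) =
  translate (c (join eps x s (strand_time s k t))) h (seg_velocity n a.2).
Proof.
move=> sp ks t1 th1 dc ctmap.
have op u : 1 / 3 < u <= 2 / 3 -> open_triangle (model_curve eps a u).
  by move=> u1; apply: segment_open => //; lra.
have -> : strand_time s k t + h = strand_time s k (t + n * h).
  by rewrite /strand_time -/n; field; rewrite gt_eqF.
have t01 : 0 <= t <= 1 by lra.
have th01 : 0 <= t + n * h <= 1 by lra.
rewrite !join_at//.
rewrite -/a !seg_curveE dc; split; first by eexists; [exact: op th1|].
rewrite !ctmap//; try exact: op.
exact: segment_straight.
Qed.

Lemma interior_crossing x s k x' s' k' (a := nth x (x :: s) k)
    (a' := nth x' (x' :: s') k') :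
  open_strand x s -> open_strand x' s' -> (k <= size s)%N -> (k' <= size s')%N ->
  a' = (a.1, a.2 + 1) ->
  interior_crosses_rl S (join eps x s) (strand_time s k (cross_out eps))
                        (join eps x' s') (strand_time s' k' (cross_in eps)).
Proof.
have [e0 e1] := (eps_gt0, eps_lt).
move=> sp sp' ks ks' aa'; have [c [pc dc ctmap]] := tmap_interior a.1.
have /andP[c1 c2] := cross_in_itv eps_gt0 eps_lt.
have co : 1 / 3 < cross_out eps <= 2 / 3 by rewrite /cross_out; lra.
have ci : 1 / 3 < cross_in eps <= 2 / 3 by lra.
set n : R := (size s).+1%:R; set n' : R := (size s').+1%:R.
have [n0 n0'] : 0 < n /\ 0 < n' by [].
have a1 : a'.1 = a.1 by rewrite aa'.
exists c, (seg_velocity n a.2), (seg_velocity n' a'.2); split => //.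
- have h0 : 1 / 3 < cross_out eps + n * 0 <= 2 / 3 by rewrite mulr0 addr0.
  have [] := @join_straight x s k (cross_out eps) 0 c sp ks co h0 dc ctmap.
  by rewrite addr0.
- by rewrite aa'; exact: det2_seg_velocity.
(* [m] is the margin of [cross_in] above 1/3 and, by symmetry, of [cross_out] below 2/3; division by
   [n + n'] keeps both local times in the middle third. *)
- pose m := cross_in eps - 1 / 3; have m0 : 0 < m by rewrite /m; lra.
  have d0 : 0 < m / (n + n') by rewrite divr_gt0// addr_gt0.
  apply/nbhs_ballP; exists (m / (n + n')) => //= h.
  rewrite /ball /= sub0r normrN ltr_pdivlMr ?addr_gt0// => hm.
  have hn : `|n * h| < m.
    rewrite normrM gtr0_norm// mulrC; apply: le_lt_trans hm.
    by rewrite ler_wpM2l// lerDl ltW.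
  have hn' : `|n' * h| < m.
    rewrite normrM gtr0_norm// mulrC; apply: le_lt_trans hm.
    by rewrite ler_wpM2l// lerDr ltW.
  move: hn hn'; rewrite !ltr_norml /m => hn hn'.
  have ho : 1 / 3 < cross_out eps + n * h <= 2 / 3.
    by move: hn; rewrite /cross_out; lra.
  have hi : 1 / 3 < cross_in eps + n' * h <= 2 / 3 by lra.
  have [? ?] := @join_straight x s k (cross_out eps) h c sp ks co ho dc ctmap.
  have dc' : dom c = tmap a'.1 @` open_triangle by rewrite a1.
  have ctmap' z : open_triangle z -> c (tmap a'.1 z) = z by rewrite a1; exact: ctmap.
  have [? ?] := @join_straight x' s' k' (cross_in eps) h c sp' ks' ci hi dc' ctmap'.
  by split.
Qed.

(* Close to the common marked point, the ending strand d runs in the last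
   triangle of its fan, next to the boundary edge before that point; a short
   straight cut of this triangle joins d to the edge and avoids the starting
   strand, even when the latter leaves through the same triangle. *)
Lemma end_crossing x s x' s' : open_strand x s -> open_strand x' s' ->
  join eps x s 0 = join eps x' s' 1 ->
  end_right_of_start S (join eps x s) (join eps x' s').
Proof.
have [e0 e1] := (eps_gt0, eps_lt).
move=> sp sp' p01; set l := last x' s'; set i := l.2 + 1.
have [sx lx'] : starts_on_boundary x /\ ends_on_boundary l.
  by split; [case/and3P: sp|case/and3P: sp'].
have [a [j bE]] := boundary_edge (eqP lx').
have g0 : join eps x s 0 = tmap l.1 (corner i) by rewrite p01 join1.
exists a, j.+1; split.
  by rewrite g0 -edge_pt0 bE ?subr0 /marked_pt ?natr1// lexx ler01.
set n : R := (size s).+1%:R; set n' : R := (size s').+1%:R.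
have n1 : 1 <= n by rewrite ler1n.
have n1' : 1 <= n' by rewrite ler1n.
(* Up to this time the starting strand stays on the first piece of its first segment. *)
have c0 : 0 < 1 / (3 * n) by rewrite divr_gt0// mulr_gt0//; lra.
near=> e => U; rewrite g0 => /(@tmap_near_corner _ _ _ T)[d d0 dU].
have e_gt0 : 0 < e by near: e; exact: nbhs_right_gt.
have e_lt1 : e < 1 by near: e; exact: nbhs_right_lt.
have : e < 1 / (3 * n) by near: e; exact: nbhs_right_lt.
rewrite ltr_pdivlMr ?mulr_gt0// => en.
(* The bound 1/3 puts local time [1 - t] on the last piece of [l]. The bound [d / 2] keeps the cut
   in [U]: along it, coordinate i is at least [1 - 3 / 2 * w] with [w < t]. *)
have [t1 [t10 t1d t13]] : exists t, [/\ 0 < t, t < d / 2 & t < 1 / 3].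
  by apply: small_pos; lra.
have [t [t0 tt1 te]] : exists t, [/\ 0 < t, t < t1 & t < e] by exact: small_pos.
pose w := 3 * (eps * t).
have w0 : 0 < w by rewrite /w !mulr_gt0.
have wt : w < t.
  have : 0 < (1 - 3 * eps) * t by apply: mulr_gt0; lra.
  by rewrite /w; lra.
have w01 : 0 <= w <= 1 by lra.
(* The cut lies on the level line [w] of coordinate i + 1, the value of that coordinate on the
   ending strand at local time [1 - t]. *)
pose z0 : R * R := edge_pt i w; pose z1 := model_curve eps l (1 - t).
have z1E : bcoord (i + 1) z1 = w /\ bcoord (i - 1) z1 = w / 2.
  have := segment_coord eps (starts_on_boundary l) (ends_on_boundary l) l.2 (1 - t).
  rewrite -/(model_curve eps l (1 - t)) -/z1 lx' /i !I3E.
  by move=> [[]|[]|[_ -> ->]]; [lra|lra|rewrite /w; lra].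
have z1t : triangle z1 by apply: model_curve_triangle => //; lra.
have z0t : triangle z0 by exact: edge_triangle.
have zE q : 0 <= q <= 1 -> let z := lerp z0 z1 q in
    [/\ bcoord (i + 1) z = w, bcoord (i - 1) z = q * w / 2,
        bcoord i z = 1 - w - q * w / 2 & 0 <= q * w <= w].
  move=> /andP[q0 q1] z.
  have h1 : bcoord (i + 1) z = w.
    by rewrite /z bcoord_lerp z1E.1 /z0 bcoord_edge !bcoordE; ring.
  have h2 : bcoord (i - 1) z = q * w / 2.
    by rewrite /z bcoord_lerp z1E.2 /z0 bcoord_edge !bcoordE mulrA.
  have := bcoord_sum i z; rewrite h1 h2 => h3.
  by split=> //; [lra|rewrite mulr_ge0 ?ler_piMl//; lra].
have zt q : 0 <= q <= 1 -> triangle (lerp z0 z1 q).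
  move=> q01; have [h1 h2 h3 h4] := zE q q01.
  by apply/(triangleP3 i); rewrite h1 h2 h3; split; lra.
have zi q : 0 <= q <= 1 -> 1 / 2 < bcoord i (lerp z0 z1 q) < 1.
  by move=> q01; have [_ _ -> h] := zE q q01; lra.
have zcorner q k : 0 <= q <= 1 -> lerp z0 z1 q <> corner k.
  move=> /zi h zk; move: h; rewrite zk bcoord_corner.
  by case: eqP => _ /=; lra.
exists (tmap l.1 @` (lerp z0 z1 @` `[0, 1])); split.
- apply: connected_continuous_connected.
    apply: connected_continuous_connected; first exact: segment_connected.
    exact/continuous_subspaceT/lerp_continuous.
  have := @tmap_continuous _ _ _ T l.1; apply: continuous_subspaceW.
  by move=> _ [q + <-]; rewrite /= in_itv /=; exact: zt.
- move=> _ [_ [q + <-] <-]; rewrite /= in_itv /= => q01; split.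
    apply: dU; first exact: zt.
    by have [_ _ -> h] := zE q q01; lra.
  move=> [u]; rewrite /= in_itv /= => /andP[u0 ue].
  have nu : n * u <= e * n by rewrite mulrC ler_wpM2r//; lra.
  have nu0 : 0 <= n * u by rewrite mulr_ge0//; lra.
  have -> : u = strand_time s 0 (n * u).
    by rewrite /strand_time add0r mulrC mulKf// gt_eqF.
  rewrite join_at//; last by lra.
  rewrite /= seg_curveE => /esym/tmap_inj.
  have v01 : 0 <= n * u <= 1 by lra.
  move=> /(_ (zt q q01) (model_curve_triangle eps_gt0 eps_lt x v01)).
  have v0P : model_curve eps x (n * u) = corner x.2 \/
      open_triangle (model_curve eps x (n * u)).
    move: nu0; rewrite le_eqVlt => /predU1P[<-|nu0].
      by left; rewrite /model_curve segment0 sx.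
    by right; apply: segment_open => //; lra.
  case=> [E| |[k [k' [/(zcorner q)//]]]].
  + have {E} E : lerp z0 z1 q = model_curve eps x (n * u) := congr1 snd E.
    have := segment_coord eps (starts_on_boundary x) (ends_on_boundary x) x.2 (n * u).
    rewrite -/(model_curve eps x (n * u)) -E sx.
    move=> [[_ m1 /= m2]|[]|[]]; [|lra|lra].
    have enu : 0 <= eps * (n * u) by rewrite mulr_ge0//; lra.
    have enu3 : eps * (n * u) <= eps * (1 / 3) by rewrite ler_pM2l//; lra.
    have m3 : 1 / 2 < bcoord x.2 (lerp z0 z1 q).
      by have := bcoord_sum x.2 (lerp z0 z1 q); rewrite m1 m2; lra.
    have /andP[hi _] := zi q q01.
    have ix := bcoord_two_large (zt q q01) hi m3.
    (* On the starting strand coordinate i - 1 is twice coordinate i + 1, on the cut it is at most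
       half of it, and [w] is positive. *)
    have [h1 h2 _ h3] := zE q q01.
    by move: m1 m2; rewrite -ix h1 h2; lra.
  + move=> [k [k' [v [_ v01' zk zk']]]].
    case: v0P; last by rewrite zk' => /open_triangle_edge.
    rewrite zk' => /edge_pt_corner v1.
    have [v0|v0] : v = 0 \/ v = 1 by case: v1 => ?; [right|left]; lra.
      by move: zk; rewrite v0 edge_pt0; exact: zcorner.
    by move: zk; rewrite v0 edge_pt1; exact: zcorner.
- exists (tmap l.1 z1); split.
    by exists z1 => //; exists 1; [rewrite /= in_itv /= ler01 lexx|rewrite lerp1].
  exists (strand_time s' (size s') (1 - t)); last first.
    by rewrite join_at// ?seg_curveE -?last_nth//; lra.
  have tE : strand_time s' (size s') (1 - t) = 1 - t / n'.
    by rewrite /strand_time -/n' /n' -natr1; field; rewrite natr1.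
  have : t / n' <= t by rewrite ler_pdivrMr ?ler_peMr//; lra.
  have : 0 < t / n' by rewrite divr_gt0//; lra.
  rewrite /= in_itv /= tE; move: (t / n') => q q0 qt.
  by apply/andP; split; lra.
- exists (tmap l.1 z0); split.
    by exists z0 => //; exists 0; [rewrite /= in_itv /= ler01 lexx|rewrite lerp0].
  exists w; first by rewrite /= in_itv /= w0; lra.
  by rewrite /z0 bE// natr1.
Unshelve. all: by end_near.
Qed.

End Crossings.

(** * The strand diagram *)

Section Postnikov.
Context {R : realType} {X : topologicalType} {S : marked_surface R X}.
Variables (T : triangulation S) (eps : R).
Hypotheses (eps_gt0 : 0 < eps) (eps_lt : eps < 1 / 3).
Implicit Types (x y : seg T) (s : seq (seg T)) (g d : R -> X) (t u : R).
Let D := strand_diagram T eps.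

Lemma strand_diagramP g :
  D g <-> exists x s, open_strand x s /\ g = join eps x s.
Proof.
by split=> -[x [s [sp ->]]]; exists x, s; rewrite -?is_strandE// is_strandE.
Qed.

Lemma strand_endpoints x s : open_strand x s ->
  exists (a : 'I_(ncomp S)) (j : nat),
    join eps x s 0 = marked_pt a j /\ join eps x s 1 = marked_pt a (j + 2).
Proof.
move=> sp; have /and3P[/eqP sx /path_fan_vertex + /eqP sl] := sp.
rewrite join0// join1// /fan_vertex.
have [a [j e]] := boundary_edge sx; have [a' [j' e']] := boundary_edge sl.
have o0 : 0 <= (0 : R) <= 1 by rewrite lexx ler01.
have o1 : 0 <= (1 : R) <= 1 by rewrite lexx ler01.
have := e 0 o0; rewrite edge_pt0 subr0 => ->.
(* The fan vertex has index j + 1 from the first boundary edge and j' from the last one; these agree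
   up to [k] turns of the circle. *)
have := e' 1 o1; rewrite edge_pt1 I3_addr2 addrK => -> /bd_inj[aa [k jk]].
subst a'; exists a, j; rewrite /marked_pt.
have := e 1 o1; rewrite edge_pt1 subrK addrK => ->; split=> //.
rewrite -edge_pt0 e'// subr0 jk natrD -[RHS](bd_periodicz _ _ k).
by congr bd; ring.
Qed.

Lemma diagram_degree : has_degree S D 2.
Proof.
move=> g a j /strand_diagramP[x [s [sp ->]]] g0.
have [a' [j' [g0' g1]]] := strand_endpoints sp.
move: g0; rewrite g1 g0' /marked_pt => /bd_inj[aa [k jk]]; subst a'.
rewrite !natrD jk -[RHS](bd_periodicz _ _ k); congr bd.
by rewrite addrAC.
Qed.

Lemma diagram_unique_start p : marked S p -> exists! g, D g /\ g 0 = p.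
Proof.
move=> [a [j pE]]; have [f [i [m e]]] := boundary_interval T a j.
have [x [s [k [sp ks xk]]]] := strand_through (f, i + 1).
have k0 : k = 0%N.
  by apply: starts_at_head sp ks _; rewrite xk /starts_on_boundary /= addrK m.
move: xk; rewrite k0 /= => xE.
have g0 : join eps x s 0 = p.
  by rewrite join0// xE /= -edge_pt1 e ?addrK ?ler01 ?lexx.
exists (join eps x s); split.
  by split=> //; apply/strand_diagramP; exists x, s.
move=> g [/strand_diagramP[x' [s' [sp' ->]]] g0'].
by have [|-> ->] := strand_eq_start eps_gt0 eps_lt sp sp'; first by rewrite g0 g0'.
Qed.

Lemma diagram_unique_end p : marked S p -> exists! g, D g /\ g 1 = p.
Proof.
move=> [a [j pE]].
have [f [i [m e]]] := boundary_interval T a (j + (nmarked a).-1).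
have [x [s [k [sp ks xk]]]] := strand_through (f, i - 1).
have k1 : k = size s.
  by apply: ends_at_last sp ks _; rewrite xk /ends_on_boundary /= subrK m.
move: xk; rewrite k1 -last_nth => lE.
have g1 : join eps x s 1 = p.
  rewrite join1// lE /= subrK -edge_pt0 e ?ler01 ?lexx// subr0 pE /marked_pt.
  rewrite -[RHS]bd_periodic natr1 -addnS prednK ?nmarked_gt0//.
  by rewrite natrD.
exists (join eps x s); split.
  by split=> //; apply/strand_diagramP; exists x, s.
move=> g [/strand_diagramP[x' [s' [sp' ->]]] g1'].
by have [|-> ->] := strand_eq_end eps_gt0 eps_lt sp sp'; first by rewrite g1 g1'.
Qed.

Lemma passesP g t p : passes D g t p -> exists x s k u,
  [/\ open_strand x s, g = join eps x s, (k <= size s)%N, 0 <= u <= 1 &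
      t = strand_time s k u].
Proof.
move=> [/strand_diagramP[x [s [sp ->]]] t01 _].
by have [k [u [ks u01 tE]]] := strand_time_onto s t01; exists x, s, k, u.
Qed.

Lemma strand_time_interior s k (t : R) : (k <= size s)%N -> 0 < t < 1 ->
  0 < strand_time s k t < 1.
Proof.
move=> ks /andP[t0 t1]; rewrite /strand_time.
rewrite divr_gt0 ?ltr_wpDl//= ltr_pdivrMr// mul1r -natr1.
by rewrite ler_ltD// ler_nat.
Qed.

Lemma strand_time_lt s k k' (t t' : R) :
  (strand_time s k t < strand_time s k' t') = (k%:R + t < k'%:R + t').
Proof. by rewrite /strand_time ltr_pM2r ?invr_gt0. Qed.

Lemma cross_in01 : 0 < cross_in eps < 1.
Proof. by have /andP[] := cross_in_itv eps_gt0 eps_lt; lra. Qed.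

Lemma cross_out01 : 0 < cross_out eps < 1.
Proof.
by have /andP[] := cross_in_itv eps_gt0 eps_lt; rewrite /cross_out; lra.
Qed.

Lemma cross_in_lt_out : cross_in eps < cross_out eps.
Proof.
by have /andP[] := cross_in_itv eps_gt0 eps_lt; rewrite /cross_out; lra.
Qed.

(** Along a strand the crossing times are start, in, out, in, out, ..., end. Grouping the start with
    the out-crossings, and the end with the in-crossings, makes the two kinds interleave. *)
Definition rl_time s (t : R) : Prop :=
  t = 0 \/ exists2 k, (k <= size s)%N & t = strand_time s k (cross_out eps).

Definition lr_time s (t : R) : Prop :=
  t = 1 \/ exists2 k, (k <= size s)%N & t = strand_time s k (cross_in eps).

Lemma meets_cases x s t d t' : open_strand x s ->
  Defs.meets D (join eps x s) t d t' ->
  (rl_time s t /\ crosses_rl S (join eps x s) t d t') \/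
  (lr_time s t /\ crosses_lr S (join eps x s) t d t').
Proof.
move=> sp [[_ t01 _] pd neq]; have [_ _ e] := pd.
have [x' [s' [k' [u' [sp' dE ks' u01' tE']]]]] := passesP pd.
have [k [u [ks u01 tE]]] := strand_time_onto s t01.
subst d t t'; case: (pass_cases eps_gt0 eps_lt sp sp' ks ks' u01 u01' (esym e)).
- by case=> xx ss vv; case: neq; rewrite vv xx ss.
- case=> -[an ue ue'].
  + left; split; first by right; exists k; rewrite ?ue.
    constructor 1; split.
    * by apply: strand_time_interior; rewrite // ue cross_out01.
    * by apply: strand_time_interior; rewrite // ue' cross_in01.
    * by rewrite ue ue'; exact: interior_crossing.
  + right; split; first by right; exists k; rewrite ?ue.
    constructor 1; split.
    * by apply: strand_time_interior; rewrite // ue' cross_out01.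
    * by apply: strand_time_interior; rewrite // ue cross_in01.
    * by rewrite ue ue'; exact: interior_crossing.
(* Where the strand ends, [d] starts; since [crosses_lr] exchanges the two curves, [end_crossing]
   serves at both ends. *)
- case=> -[v v']; move: e; rewrite v v' => e.
  + left; split; first by left.
    by constructor 2; split=> //; exact: end_crossing.
  + right; split; first by left.
    by constructor 2; split=> //; exact: end_crossing.
Qed.

(** Alternation needs that these crossings really occur: the neighbouring segments of the triangle
    also lie on strands, possibly on the same one. *)
Lemma meets_crossing x s k : open_strand x s -> (k <= size s)%N ->
  (exists d t,
    Defs.meets D (join eps x s) (strand_time s k (cross_in eps)) d t) /\
  (exists d t,
    Defs.meets D (join eps x s) (strand_time s k (cross_out eps)) d t).
Proof.
move=> sp ks; set y := nth x (x :: s) k.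
have ci := cross_in01; have co := cross_out01; have cio := cross_in_lt_out.
have ci' : 0 <= cross_in eps <= 1 by lra.
have co' : 0 <= cross_out eps <= 1 by lra.
have meet (z : seg T) (u u' : R) :
    0 <= u <= 1 -> 0 <= u' <= 1 -> 0 < `|u - u'| < 1 ->
    seg_curve eps y u = seg_curve eps z u' ->
    exists d t, Defs.meets D (join eps x s) (strand_time s k u) d t.
  move=> u01 u01' uu e.
  have [x' [s' [k' [sp' ks' zE]]]] := strand_through z.
  exists (join eps x' s'), (strand_time s' k' u'); split.
  - split=> //; first by apply/strand_diagramP; exists x, s.
    exact: strand_time_itv.
  - split; first by apply/strand_diagramP; exists x', s'.
      exact: strand_time_itv.
    by rewrite !join_at// zE -e.
  (* If the passes were the same, [k + u] and [k' + u'] would be equal, although [u] and [u'] do not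
     differ by an integer. *)
  - move=> h; have := congr1 snd h; have /= := congr1 fst h.
    move=> /(join_inj eps_gt0 eps_lt sp sp')[_ <-].
    rewrite /strand_time => /(mulIf _) h'.
    have {h'} : k%:R + u = k'%:R + u' by apply: h'; rewrite invr_eq0.
    move: uu; case: (ltngtP k k') => [kk|kk|->] uu h'.
    + have : k%:R + 1 <= k'%:R :> R by rewrite natr1 ler_nat.
      move: uu; rewrite ltr_norml; lra.
    + have : k'%:R + 1 <= k%:R :> R by rewrite natr1 ler_nat.
      move: uu; rewrite ltr_norml; lra.
    + by move: h' uu => /addrI ->; rewrite subrr normr0 ltxx.
split.
- apply: (meet (y.1, y.2 - 1) _ (cross_out eps)) => //.
    by rewrite distrC gtr0_norm; lra.
  rewrite !seg_curveE /model_curve /=; congr tmap.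
  by rewrite -{1}[y.2](subrK 1); exact/esym/segment_cross.
- apply: (meet (y.1, y.2 + 1) _ (cross_in eps)) => //.
    by rewrite gtr0_norm; lra.
  by rewrite !seg_curveE /model_curve /=; congr tmap; exact: segment_cross.
Qed.

(** The later time cannot be 0, so it is an out-crossing, and the in-crossing of the same segment is
    the witness. In [lr_time_gap] the earlier time plays this part. *)
Lemma rl_time_gap s t t' : rl_time s t -> rl_time s t' -> t < t' ->
  exists2 k, (k <= size s)%N & t < strand_time s k (cross_in eps) < t'.
Proof.
have ci := cross_in01; have co := cross_out01; have cio := cross_in_lt_out.
have t0 u : rl_time s u -> 0 <= u.
  case=> [->|[k ks ->]]; first exact: lexx.
  by have /andP[/ltW] := strand_time_interior ks co.
move=> tr [->|[k' ks' ->]] tt'; first by have := t0 _ tr; rewrite leNgt tt'.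
exists k' => //; rewrite strand_time_lt; apply/andP; split; last by lra.
case: tr tt' => [->|[k ks ->]].
  by move=> _; have /andP[] := strand_time_interior ks' ci.
rewrite !strand_time_lt => kk.
have : (k < k')%N by rewrite -(ltr_nat R); lra.
by rewrite -(ler_nat R) -natr1; lra.
Qed.

Lemma lr_time_gap s t t' : lr_time s t -> lr_time s t' -> t < t' ->
  exists2 k, (k <= size s)%N & t < strand_time s k (cross_out eps) < t'.
Proof.
have ci := cross_in01; have co := cross_out01; have cio := cross_in_lt_out.
have t1 u : lr_time s u -> u <= 1.
  case=> [->|[k ks ->]]; first exact: lexx.
  by have /andP[_ /ltW] := strand_time_interior ks ci.
move=> [->|[k ks ->]] tr tt'; first by have := t1 _ tr; rewrite leNgt tt'.
exists k => //; rewrite strand_time_lt; apply/andP; split; first by lra.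
case: tr tt' => [->|[k' ks' ->]].
  by move=> _; have /andP[] := strand_time_interior ks co.
rewrite !strand_time_lt => kk.
have : (k < k')%N by rewrite -(ltr_nat R); lra.
by rewrite -(ler_nat R) -natr1; lra.
Qed.

Lemma diagram_alternating g t t' d u d' u' : t < t' ->
  Defs.meets D g t d u -> Defs.meets D g t' d' u' ->
  (forall t'' d'' u'', t < t'' < t' -> ~ Defs.meets D g t'' d'' u'') ->
  (crosses_lr S g t d u /\ crosses_rl S g t' d' u') \/
  (crosses_rl S g t d u /\ crosses_lr S g t' d' u').
Proof.
move=> tt m m' between; have [/passesP[x [s [_ [_ [sp gE _ _ _]]]]] _ _] := m.
subst g; case: (meets_cases sp m) (meets_cases sp m') => -[h c] [] [h' c'].
- have [k ks kt] := rl_time_gap h h' tt.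
  by have [[e [v /(between _ _ _ kt)[]]] _] := meets_crossing sp ks.
- by right.
- by left.
- have [k ks kt] := lr_time_gap h h' tt.
  by have [_ [e [v /(between _ _ _ kt)[]]]] := meets_crossing sp ks.
Qed.

Lemma diagram_at_most_two p g1 t1 g2 t2 g3 t3 :
  passes D g1 t1 p -> passes D g2 t2 p -> passes D g3 t3 p ->
  [\/ (g1, t1) = (g2, t2), (g1, t1) = (g3, t3) | (g2, t2) = (g3, t3)].
Proof.
move=> p1 p2 p3.
have [[[_ _ e1] [_ _ e2]] [_ _ e3]] := (p1, p2, p3).
have [x1 [s1 [k1 [u1 [sp1 gE1 ks1 u01 tE1]]]]] := passesP p1.
have [x2 [s2 [k2 [u2 [sp2 gE2 ks2 u02 tE2]]]]] := passesP p2.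
have [x3 [s3 [k3 [u3 [sp3 gE3 ks3 u03 tE3]]]]] := passesP p3.
have ci := cross_in01; have co := cross_out01; have cio := cross_in_lt_out.
(* Two distinct passes through the same point have complementary times (local
   times inside a triangle, global ones at a marked point), neither being 1/2. *)
have compl (x : seg T) s k u (x' : seg T) s' k' u' :
    open_strand x s -> open_strand x' s' ->
    (k <= size s)%N -> (k' <= size s')%N -> 0 <= u <= 1 -> 0 <= u' <= 1 ->
    join eps x s (strand_time s k u) = join eps x' s' (strand_time s' k' u') ->
    [\/ (join eps x s, strand_time s k u) = (join eps x' s', strand_time s' k' u'),
        (0 < strand_time s k u < 1 /\ 0 < strand_time s' k' u' < 1) /\
          (u <> 1 / 2 /\ u' = 1 - u),
        strand_time s k u = 0 /\ strand_time s' k' u' = 1 |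
        strand_time s k u = 1 /\ strand_time s' k' u' = 0].
  move=> sp sp' ks ks' u01' u02'.
  move=> /(pass_cases eps_gt0 eps_lt sp sp' ks ks' u01' u02').
  case=> [[-> -> ->]|[] [_ -> ->]|[]]; [by constructor 1| | | |].
  - constructor 2; split; split; try exact: strand_time_interior.
      by move: cio; rewrite /cross_out; lra.
    by rewrite /cross_out; lra.
  - constructor 2; split; split; try exact: strand_time_interior.
      by move: cio; rewrite /cross_out; lra.
    by rewrite /cross_out; lra.
  - by constructor 3.
  - by constructor 4.
subst g1 g2 g3 t1 t2 t3.
have := compl _ _ _ _ _ _ _ _ sp1 sp2 ks1 ks2 u01 u02 (etrans e1 (esym e2)).
have := compl _ _ _ _ _ _ _ _ sp1 sp3 ks1 ks3 u01 u03 (etrans e1 (esym e3)).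
have := compl _ _ _ _ _ _ _ _ sp2 sp3 ks2 ks3 u02 u03 (etrans e2 (esym e3)).
case=> [->|h23|h23|h23]; first by constructor 3.
all: case=> [->|h13|h13|h13]; first by constructor 2.
all: case=> [->|h12|h12|h12]; first by constructor 1.
(* Three pairwise complementary local times would all be 1/2, and three global times in {0, 1}
   cannot be pairwise distinct. *)
all: exfalso; move: h12 h13 h23 {e1 e2 e3 p1 p2 p3}.
all: move: (strand_time s1 k1 u1) (strand_time s2 k2 u2) (strand_time s3 k3 u3).
all: move=> v1 v2 v3.
all: by move=> h12 h13 h23; lra.
Qed.

Lemma diagram_finite_crossings : finite_set (crossing_pt D).
Proof.
pose start y := tmap y.1 (corner y.2 : R * R).
pose stop y := tmap y.1 (corner (y.2 + 1) : R * R).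
pose F (h : seg T -> X) := h @` [set: seg T].
apply: (@sub_finite_set _ _ (F start `|` F stop `|`
  (F (fun y => seg_curve eps y (cross_in eps)) `|`
   F (fun y => seg_curve eps y (cross_out eps))))).
  have ci : 0 <= cross_in eps <= 1 by have := cross_in01; lra.
  have co : 0 <= cross_out eps <= 1 by have := cross_out01; lra.
  move=> _ [g [t [d [u [<- m]]]]].
  have [/passesP[x [s [_ [_ [sp gE _ _ _]]]]] _ _] := m; subst g.
  case: (meets_cases sp m) => -[[->|[k ks ->]] _].
  - by left; left; exists x => //; rewrite join0.
  - by right; right; exists (nth x (x :: s) k) => //; rewrite join_at.
  - by left; right; exists (last x s) => //; rewrite join1.
  - by right; left; exists (nth x (x :: s) k) => //; rewrite join_at.
by rewrite !finite_setU; do ![split]; apply: finite_image; exact: finite_finset.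
Qed.

Lemma diagram_weak_postnikov : weak_postnikov S D.
Proof.
split.
- by move=> g /strand_diagramP[x [s [sp ->]]]; exact: join_continuous.
- move=> g /strand_diagramP[x [s [sp ->]]].
  by have [a [j [h0 h1]]] := strand_endpoints sp; exists a, j, (j + 2)%N.
- exact: diagram_unique_start.
- exact: diagram_unique_end.
- exact: diagram_at_most_two.
- move=> g t d u m; have [/passesP[x [s [_ [_ [sp gE _ _ _]]]]] _ _] := m.
  by subst g; case: (meets_cases sp m) => -[_]; [left|right].
- exact: diagram_finite_crossings.
- exact: diagram_alternating.
Qed.

End Postnikov.

Theorem lemma13p3 (R : realType) (X : topologicalType)
    (S : marked_surface R X) (T : triangulation S)
    (eps : R) (eps_gt0 : 0 < eps) (eps_lt : eps < 1 / 3) :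
  weak_postnikov S (strand_diagram T eps) /\
  has_degree S (strand_diagram T eps) 2.
Proof. by split; [exact: diagram_weak_postnikov|exact: diagram_degree]. Qed.
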